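(* Let $(X_1,X_2,X_3)$ be a $3$-chambar in one variable, i.e. on a connected open subset $\mathcal{U}$ of $\mathbb{R}$ (real case) or of $\mathbb{C}$ (complex case). In the real case, the chambar is constant, i.e. $X_1,X_2,X_3$ are distinct constant vector fields. In the complex case, either the chambar is constant, or, up to order, $$(X_1,X_2,X_3)=\Big(a(x)\frac{\partial}{\partial x},\ \mathbf{j}\,a(x)\frac{\partial}{\partial x},\ \mathbf{j}^2a(x)\frac{\partial}{\partial x}\Big),$$ where $\mathbf{j}$ is a primitive cube root of unity and $a(x)=\sqrt{\lambda x+\mu}$ (a holomorphic branch on $\mathcal{U}$) with $\lambda\in\mathbb{C}^*$ and $\mu\in\mathbb{C}$.
   Context: Let $\mathbb{K}=\mathbb{R}$ or $\mathbb{C}$. For a real analytic (resp. holomorphic) vector field $X$ on an open set $\mathcal{U}\subset\mathbb{K}$, $\exp(tX)$ denotes its local flow. A $p$-chambar on $\mathcal{U}$ is a set of $p$ pairwise distinct, not identically zero real analytic (resp. holomorphic) vector fields $X_1,\dots,X_p$ on $\mathcal{U}$ satisfying the barycentric property: $\sum_{k=1}^p X_k(\exp(tX_k)(x))=0$ for all $x\in\mathcal{U}$ and all small $t\in\mathbb{K}$; equivalently $\sum_{k=1}^p\exp(tX_k)(x)=p\,x$. *)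

(* Defs.v *)
From Stdlib Require Import Reals.
From Coquelicot Require Import Coquelicot.

(* A vector field on an open subset [U] of the line [K] is encoded by its
   coefficient, a total function [K -> K] whose values outside [U] are
   irrelevant. *)

Definition connected {T : UniformSpace} (U : T -> Prop) : Prop :=
  forall A B : T -> Prop, open A -> open B ->
    (forall x, U x -> A x \/ B x) ->
    (exists x, U x /\ A x) -> (exists x, U x /\ B x) ->
    exists x, U x /\ A x /\ B x.

Definition real_analytic_on (U : R -> Prop) (f : R -> R) : Prop :=
  forall x0 : R, U x0 ->
    exists a : nat -> R, locally x0 (fun x => is_pseries a (x - x0)%R (f x)).

(* The scalar field of [ex_derive] is the domain [C_AbsRing]: this is
   complex differentiability. *)
Definition holomorphic_on (U : C -> Prop) (f : C -> C) : Prop :=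
  forall z : C, U z -> @ex_derive C_AbsRing (AbsRing_NormedModule C_AbsRing) f z.

(* [E t x] is exp(tX)(x).  It is only constrained for [x] in [U] and for [t]
   in a neighbourhood of 0 which may depend on [x]; its germ at [t = 0] is
   then determined by [X] and [x]. *)
Definition is_local_flow {K : AbsRing} (U : K -> Prop) (X : K -> K)
    (E : K -> K -> K) : Prop :=
  forall x : K, U x ->
    E zero x = x /\
    locally (zero : K) (fun t : K =>
      U (E t x) /\
      @is_derive K (AbsRing_NormedModule K) (fun s : K => E s x) t (X (E t x))).

Definition barycentric {K : AbsRing} (p : nat) (U : K -> Prop)
    (X : nat -> K -> K) : Prop :=
  exists E : nat -> K -> K -> K,
    (forall k, (1 <= k <= p)%nat -> is_local_flow U (X k) (E k)) /\
    (forall x : K, U x ->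
       locally (zero : K) (fun t : K =>
         sum_n_m (fun k => X k (E k t x)) 1 p = zero)).

(* The fields of a [p]-chambar are [X 1], ..., [X p]; [regular_on] is
   [real_analytic_on] or [holomorphic_on]. *)
Definition is_chambar {K : AbsRing}
    (regular_on : (K -> Prop) -> (K -> K) -> Prop)
    (p : nat) (U : K -> Prop) (X : nat -> K -> K) : Prop :=
  (forall k, (1 <= k <= p)%nat -> regular_on U (X k)) /\
  (forall k, (1 <= k <= p)%nat -> exists x, U x /\ X k x <> zero) /\
  (forall k l, (1 <= k <= p)%nat -> (1 <= l <= p)%nat -> k <> l ->
     exists x, U x /\ X k x <> X l x) /\
  barycentric p U X.

Definition real_chambar : nat -> (R -> Prop) -> (nat -> R -> R) -> Prop :=
  @is_chambar R_AbsRing real_analytic_on.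

Definition complex_chambar : nat -> (C -> Prop) -> (nat -> C -> C) -> Prop :=
  @is_chambar C_AbsRing holomorphic_on.

Definition constant_fields {K : Type} (p : nat) (U : K -> Prop)
    (X : nat -> K -> K) : Prop :=
  exists c : nat -> K,
    (forall k, (1 <= k <= p)%nat -> forall x, U x -> X k x = c k) /\
    (forall k l, (1 <= k <= p)%nat -> (1 <= l <= p)%nat -> k <> l -> c k <> c l).

Definition primitive_root (n : nat) (z : C) : Prop :=
  (z ^ n)%C = RtoC 1 /\
  forall m, (0 < m < n)%nat -> (z ^ m)%C <> RtoC 1.

(* Main.v *)
Require Import Defs.
From Stdlib Require Import Reals Factorial List Permutation Lra Lia Psatz.
From Stdlib Require Import Classical ClassicalEpsilon.
From Coquelicot Require Import Coquelicot.

(* Differentiating the barycentric identity repeatedly along the flows gives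
   [sum X = 0], [sum X X' = 0], [sum X (X X')' = 0] and
   [sum X (X (X X')')' = 0].  So [c = sum X^2] is constant, and the fields are
   the roots of a cubic whose only variable coefficient is [q = X1 X2 X3].  If
   [c <> 0], write [X1' = w (X2 - X3)] and cyclically: the last identity reads
   [c^2 w w' = 0] up to a factor, the previous one then gives [w^2 q = 0], hence
   [q q' = 0] everywhere and everything is constant.  If [c = 0] (impossible
   over the reals) the fields are [a], [j a], [j^2 a] and the third identity
   becomes [(a^2)'' = 0] wherever [a <> 0].

   Three derivatives of the fields are needed while [holomorphic_on] only
   provides one.  Where [X <> 0] the flow of [X] in time is a [C^1] map with
   invertible derivative; its local inverse has the continuous derivative
   [1 / X], so Cauchy's formula for holomorphic functions with continuous
   derivative shows that it, and hence [X], is smooth. *)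

(** * Algebra of the jets *)

(** The form [x1^2 + x2^2 + x3^2] is nondegenerate on the plane [x1 + x2 + x3 = 0], which explains
    the two cases. If [(X1, X2, X3)] is not isotropic, it forms an orthogonal basis of the plane
    with [(X2 - X3, X3 - X1, X1 - X2)], and [sum X X' = 0] leaves [w] as the only coordinate of the
    derivative. If it is nonzero and isotropic, its orthogonal is its own line, so the derivatives
    are multiples of it. The zeros of the fields are the obstacle: in the complex case the flow
    gives no regularity at an equilibrium, so the higher derivatives are used only where [q <> 0],
    and conclusions must be carried across the zeros of [q] by other means. [sum X = 0] and
    [sum X X' = 0] involve first derivatives at most and hold everywhere. For [c <> 0] the function
    to study is [q^2], since its derivative [2 q q'] vanishes at the zeros of [q] as well. For
    [c = 0], a function whose second derivative vanishes off its zeros is shown to remain one and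
    the same affine function across them. *)

Lemma Cmult_eq_0 (a b : C) : (a * b = 0)%C -> a = 0%C \/ b = 0%C.
Proof.
intros H. destruct (Ceq_dec a 0) as [Ha|Ha]; auto.
destruct (Ceq_dec b 0) as [Hb|Hb]; auto.
exfalso. exact (Cmult_neq_0 a b Ha Hb H).
Qed.

Lemma Cnonzero_num (n : Z) : n <> 0%Z -> RtoC (IZR n) <> 0%C.
Proof. intros Hn H. apply RtoC_inj in H. apply Hn. now apply eq_IZR. Qed.

Lemma plane_coordinates (x1 x2 x3 y1 y2 y3 : C) :
  (x1 + x2 + x3 = 0)%C -> (y1 + y2 + y3 = 0)%C ->
  let c := (x1 * x1 + x2 * x2 + x3 * x3)%C in
  let s := (x1 * y1 + x2 * y2 + x3 * y3)%C in
  c <> 0%C ->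
  exists w : C,
    (y1 = w * (x2 - x3) + s / c * x1)%C /\
    (y2 = w * (x3 - x1) + s / c * x2)%C /\
    (y3 = w * (x1 - x2) + s / c * x3)%C.
Proof.
intros Hx Hy c s Hc.

(* Orthogonal projection of [y] on [(x2 - x3, x3 - x1, x1 - x2)], whose sum of squares is [3 c] on
   the plane. *)
exists ((y1 * (x2 - x3) + y2 * (x3 - x1) + y3 * (x1 - x2)) / (3 * c))%C.
assert (Ex : x3 = (- x1 - x2)%C)
  by (replace x3 with ((x1 + x2 + x3) - x1 - x2)%C by ring; rewrite Hx; ring).
assert (Ey : y3 = (- y1 - y2)%C)
  by (replace y3 with ((y1 + y2 + y3) - y1 - y2)%C by ring; rewrite Hy; ring).
unfold s, c in *; clear s c; subst x3 y3.
repeat split; field; exact Hc.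
Qed.

(** The letters [x], [y], [z], [t] are the values at one point of the fields and their first three
    derivatives. The first six relations that follow from [sum X = 0] and [sum X X' = 0] fix the
    component of [y], [z], [t] along [x]; the remaining coordinates are [w], [v], [u]. The last two
    relations are the expanded [sum X (X X')'] and [sum X (X (X X')')']. They are read pointwise,
    [v] playing the part of [w']. *)
Lemma jet_rigid (x1 x2 x3 y1 y2 y3 z1 z2 z3 t1 t2 t3 : C) :
  (x1 + x2 + x3 = 0)%C -> (y1 + y2 + y3 = 0)%C ->
  (z1 + z2 + z3 = 0)%C -> (t1 + t2 + t3 = 0)%C ->
  (x1 * y1 + x2 * y2 + x3 * y3 = 0)%C ->
  ((y1 * y1 + x1 * z1) + (y2 * y2 + x2 * z2) + (y3 * y3 + x3 * z3) = 0)%C ->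
  ((3 * y1 * z1 + x1 * t1) + (3 * y2 * z2 + x2 * t2) + (3 * y3 * z3 + x3 * t3)
    = 0)%C ->
  ((x1 * y1 ^ 2 + x1 ^ 2 * z1) + (x2 * y2 ^ 2 + x2 ^ 2 * z2)
    + (x3 * y3 ^ 2 + x3 ^ 2 * z3) = 0)%C ->
  ((x1 * y1 ^ 3 + 4 * x1 ^ 2 * y1 * z1 + x1 ^ 3 * t1)
    + (x2 * y2 ^ 3 + 4 * x2 ^ 2 * y2 * z2 + x2 ^ 3 * t2)
    + (x3 * y3 ^ 3 + 4 * x3 ^ 2 * y3 * z3 + x3 ^ 3 * t3) = 0)%C ->
  (x1 * x1 + x2 * x2 + x3 * x3 <> 0)%C -> (x1 * x2 * x3 <> 0)%C ->
  y1 = 0%C /\ y2 = 0%C /\ y3 = 0%C.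
Proof.
intros Sx Sy Sz St Sxy Sxz Sxt R2 R3 Hc Hq.
destruct (plane_coordinates x1 x2 x3 y1 y2 y3 Sx Sy Hc) as [w [Y1 [Y2 Y3]]].
destruct (plane_coordinates x1 x2 x3 z1 z2 z3 Sx Sz Hc) as [v [Z1 [Z2 Z3]]].
destruct (plane_coordinates x1 x2 x3 t1 t2 t3 Sx St Hc) as [u [T1 [T2 T3]]].
set (c := (x1 * x1 + x2 * x2 + x3 * x3)%C) in *.
rewrite Sxy in Y1, Y2, Y3.
assert (Ex : x3 = (- x1 - x2)%C)
  by (replace x3 with ((x1 + x2 + x3) - x1 - x2)%C by ring; rewrite Sx; ring).
assert (Y1' : y1 = (w * (x2 - x3))%C) by (rewrite Y1; field; exact Hc).
assert (Y2' : y2 = (w * (x3 - x1))%C) by (rewrite Y2; field; exact Hc).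
assert (Y3' : y3 = (w * (x1 - x2))%C) by (rewrite Y3; field; exact Hc).
assert (Ez : (x1 * z1 + x2 * z2 + x3 * z3 = - 3 * w ^ 2 * c)%C).
{ transitivity (((y1 * y1 + x1 * z1) + (y2 * y2 + x2 * z2) + (y3 * y3 + x3 * z3))
     - (y1 * y1 + y2 * y2 + y3 * y3))%C; [ring|].
  rewrite Sxz, Y1', Y2', Y3'. unfold c. rewrite Ex. ring. }
rewrite Ez in Z1, Z2, Z3.
assert (Z1' : z1 = (v * (x2 - x3) - 3 * w ^ 2 * x1)%C)
  by (rewrite Z1; field; exact Hc).
assert (Z2' : z2 = (v * (x3 - x1) - 3 * w ^ 2 * x2)%C)
  by (rewrite Z2; field; exact Hc).
assert (Z3' : z3 = (v * (x1 - x2) - 3 * w ^ 2 * x3)%C)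
  by (rewrite Z3; field; exact Hc).
assert (Et : (x1 * t1 + x2 * t2 + x3 * t3 = - 9 * w * v * c)%C).
{ transitivity (((3 * y1 * z1 + x1 * t1) + (3 * y2 * z2 + x2 * t2)
     + (3 * y3 * z3 + x3 * t3)) - 3 * (y1 * z1 + y2 * z2 + y3 * z3))%C; [ring|].
  rewrite Sxt, Y1', Y2', Y3', Z1', Z2', Z3'. unfold c. rewrite Ex. ring. }
rewrite Et in T1, T2, T3.
assert (T1' : t1 = (u * (x2 - x3) - 9 * w * v * x1)%C)
  by (rewrite T1; field; exact Hc).
assert (T2' : t2 = (u * (x3 - x1) - 9 * w * v * x2)%C)
  by (rewrite T2; field; exact Hc).
assert (T3' : t3 = (u * (x1 - x2) - 9 * w * v * x3)%C)
  by (rewrite T3; field; exact Hc).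
clear Y1 Y2 Y3 Z1 Z2 Z3 T1 T2 T3 Sxy Sxz Sxt Ez Et Sy Sz St.
(* The coefficients of [u] and of [w^3] are alternating of degree 4, hence multiples of
   [x1 + x2 + x3], and disappear. The sums of [x1^4] and of [x1^2 (x2 - x3)^2] both equal [c^2 / 2],
   which leaves [(4 - 9) w v c^2 / 2]; doubling avoids the fraction. *)
assert (R3' : (- 5 * (c * c * (w * v)) = 0)%C).
{ transitivity (2 * 0)%C; [rewrite <- R3 | ring].
  rewrite Y1', Y2', Y3', Z1', Z2', Z3', T1', T2', T3'.
  unfold c. rewrite Ex. ring. }
assert (R2' : (- 18 * (w ^ 2 * (x1 * x2 * x3))
   + v * (x1 ^ 2 * (x2 - x3) + x2 ^ 2 * (x3 - x1) + x3 ^ 2 * (x1 - x2)) = 0)%C).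
{ rewrite <- R2. rewrite Y1', Y2', Y3', Z1', Z2', Z3'. rewrite Ex. ring. }
assert (Hw : w = 0%C).
{ destruct (Ceq_dec w 0) as [|Hw]; auto. exfalso.
  assert (Hv : v = 0%C).
  { destruct (Cmult_eq_0 _ _ R3') as [H|H].
    - now apply (Cnonzero_num (- 5)) in H.
    - destruct (Cmult_eq_0 _ _ H) as [H1|H1].
      + destruct (Cmult_eq_0 _ _ H1); now elim Hc.
      + destruct (Cmult_eq_0 _ _ H1); auto. now elim Hw. }
  rewrite Hv in R2'.
  assert (R2'' : (- 18 * (w ^ 2 * (x1 * x2 * x3)) = 0)%C)
    by (rewrite <- R2'; ring).
  destruct (Cmult_eq_0 _ _ R2'') as [H|H].
  - now apply (Cnonzero_num (- 18)) in H.
  - destruct (Cmult_eq_0 _ _ H) as [H1|H1]; [|now elim Hq].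
    revert H1. now apply Cpow_nz. }
rewrite Y1', Y2', Y3', Hw. repeat split; ring.
Qed.

(** Writing [y = p x] and [z = s x], the last relation is [(p^2 + s)] times the sum of the cubes,
    and that sum is [3 x1 x2 x3] on the plane. The conclusion is half the second derivative of the
    square of each field. *)
Lemma jet_isotropic (x1 x2 x3 y1 y2 y3 z1 z2 z3 : C) :
  (x1 + x2 + x3 = 0)%C -> (y1 + y2 + y3 = 0)%C -> (z1 + z2 + z3 = 0)%C ->
  (x1 * y1 + x2 * y2 + x3 * y3 = 0)%C ->
  ((y1 * y1 + x1 * z1) + (y2 * y2 + x2 * z2) + (y3 * y3 + x3 * z3) = 0)%C ->
  ((x1 * y1 ^ 2 + x1 ^ 2 * z1) + (x2 * y2 ^ 2 + x2 ^ 2 * z2)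
    + (x3 * y3 ^ 2 + x3 ^ 2 * z3) = 0)%C ->
  (x1 * x1 + x2 * x2 + x3 * x3 = 0)%C -> (x1 * x2 * x3 <> 0)%C ->
  (y1 * y1 + x1 * z1 = 0)%C /\ (y2 * y2 + x2 * z2 = 0)%C.
Proof.
intros Sx Sy Sz Sxy Sxz R2 Hc Hq.
assert (Ex : x3 = (- x1 - x2)%C)
  by (replace x3 with ((x1 + x2 + x3) - x1 - x2)%C by ring; rewrite Sx; ring).
assert (Ey : y3 = (- y1 - y2)%C)
  by (replace y3 with ((y1 + y2 + y3) - y1 - y2)%C by ring; rewrite Sy; ring).
assert (Ez : z3 = (- z1 - z2)%C)
  by (replace z3 with ((z1 + z2 + z3) - z1 - z2)%C by ring; rewrite Sz; ring).
subst x3 y3 z3.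
assert (Hx1 : x1 <> 0%C) by (intros ->; apply Hq; ring).
assert (Hx2 : x2 <> 0%C) by (intros ->; apply Hq; ring).
assert (H2 : RtoC 2 <> 0%C) by (apply Cnonzero_num; lia).
assert (Hiso : (x2 * x2 = - x1 * x1 - x1 * x2)%C).
{ assert (H : (2 * (x1 * x1 + x1 * x2 + x2 * x2) = 0)%C) by (rewrite <- Hc; ring).
  destruct (Cmult_eq_0 _ _ H) as [H'|H']; [now elim H2|].
  transitivity ((x1 * x1 + x1 * x2 + x2 * x2) - x1 * x1 - x1 * x2)%C; [ring|].
  rewrite H'; ring. }
assert (Hn : (x1 + 2 * x2 <> 0)%C).
{ intros H. assert (H' : (- 3 * (x1 * x1) = 0)%C).
  { transitivity (x1 * x1 + 4 * x1 * x2 + 4 * (x2 * x2))%C; [rewrite Hiso; ring|].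
    transitivity ((x1 + 2 * x2) * (x1 + 2 * x2))%C; [ring | rewrite H; ring]. }
  destruct (Cmult_eq_0 _ _ H') as [H1|H1].
  - now apply (Cnonzero_num (- 3)) in H1.
  - destruct (Cmult_eq_0 _ _ H1); now elim Hx1. }
(* The relations make [y] and [z] proportional to [x] = x1 (1, w, w^2). *)
assert (prop : forall a b r : C,
   (x1 * a + x2 * b + (- x1 - x2) * (- a - b) = r)%C -> r = 0%C ->
   (x1 * b = x2 * a)%C).
{ intros a b r H Hr.
  assert (H' : ((x1 + 2 * x2) * (x1 * b - x2 * a) = 0)%C).
  { transitivity (x1 * (x1 * a + x2 * b + (- x1 - x2) * (- a - b))
      - 2 * a * (x1 * x1 + x1 * x2 + x2 * x2))%C; [ring|].
    rewrite H, Hr, Hiso. ring. }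
  destruct (Cmult_eq_0 _ _ H') as [H1|H1]; [now elim Hn|].
  now apply Ceq_minus. }
assert (Py := prop y1 y2 _ Sxy eq_refl).
set (p := (y1 / x1)%C).
assert (Y1 : y1 = (p * x1)%C) by (unfold p; field; auto).
assert (Y2 : y2 = (p * x2)%C).
{ transitivity ((x1 * y2) / x1)%C; [field; auto|]. rewrite Py. unfold p. field; auto. }
assert (Hs : (x1 * z1 + x2 * z2 + (- x1 - x2) * (- z1 - z2) = 0)%C).
{ rewrite <- Sxz. rewrite Y1, Y2.
  transitivity (x1 * z1 + x2 * z2 + (- x1 - x2) * (- z1 - z2)
    + 2 * p ^ 2 * (x1 * x1 + x1 * x2 + x2 * x2))%C; [rewrite Hiso; ring | ring]. }
assert (Pz := prop z1 z2 _ Hs eq_refl).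
set (s := (z1 / x1)%C).
assert (Z1 : z1 = (s * x1)%C) by (unfold s; field; auto).
assert (Z2 : z2 = (s * x2)%C).
{ transitivity ((x1 * z2) / x1)%C; [field; auto|]. rewrite Pz. unfold s. field; auto. }
assert (H3 : (3 * ((x1 * x2 * (- x1 - x2)) * (p ^ 2 + s)) = 0)%C).
{ rewrite <- R2. rewrite Y1, Y2, Z1, Z2. ring. }
assert (Hps : (p ^ 2 + s = 0)%C).
{ destruct (Cmult_eq_0 _ _ H3) as [H|H].
  - now apply (Cnonzero_num 3) in H.
  - destruct (Cmult_eq_0 _ _ H); auto. now elim Hq. }
split.
- transitivity (x1 ^ 2 * (p ^ 2 + s))%C; [rewrite Y1, Z1; ring | rewrite Hps; ring].
- transitivity (x2 ^ 2 * (p ^ 2 + s))%C; [rewrite Y2, Z2; ring | rewrite Hps; ring].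
Qed.

(** * Chambars over a subfield of [C] *)

(** When the truth value of [P] is locally constant, [P] and its negation cut [U] into two open
    pieces. This is the only tool used to pass from local to global statements. *)
Lemma connected_propagation {T : UniformSpace} (U P : T -> Prop) :
  open U -> connected U ->
  (forall x, U x -> locally x (fun y => P y <-> P x)) ->
  forall x y, U x -> U y -> P x -> P y.
Proof.
intros oU cU Hloc x0 y0 Hx0 Hy0 Px0.
destruct (classic (P y0)) as [H|H]; auto. exfalso.
destruct (cU (fun x => U x /\ P x) (fun x => U x /\ ~ P x))
  as [x [_ [[_ H1] [_ H2]]]]; auto.
- intros x [Ux Hx]. generalize (filter_and _ _ (oU x Ux) (Hloc x Ux)).
  apply filter_imp. tauto.
- intros x [Ux Hx]. generalize (filter_and _ _ (oU x Ux) (Hloc x Ux)).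
  apply filter_imp. tauto.
- intros x Ux. destruct (classic (P x)); auto.
- exists x0; auto.
- exists y0; auto.
Qed.

Lemma connected_locally_constant {T : UniformSpace} {S : Type}
    (U : T -> Prop) (f : T -> S) :
  open U -> connected U ->
  (forall x, U x -> locally x (fun y => f y = f x)) ->
  forall x y, U x -> U y -> f y = f x.
Proof.
intros oU cU Hloc x y Ux Uy.
apply (connected_propagation U (fun y => f y = f x) oU cU) with x; auto.
intros z Uz. generalize (Hloc z Uz). apply filter_imp. intros w E. now rewrite E.
Qed.

Lemma sum_1_3 {G : AbelianMonoid} (f : nat -> G) :
  sum_n_m f 1 3 = plus (f 1%nat) (plus (f 2%nat) (f 3%nat)).
Proof.
rewrite sum_Sn_m by lia. rewrite sum_Sn_m by lia. now rewrite sum_n_n.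
Qed.

Lemma is_derive_sum_1_3 {K : AbsRing} (f : nat -> K -> K) (x : K) (d : nat -> K) :
  (forall k, (1 <= k <= 3)%nat -> is_derive (f k) x (d k)) ->
  is_derive (fun y => sum_n_m (fun k => f k y) 1 3) x (sum_n_m d 1 3).
Proof.
intros H.
apply (is_derive_ext
  (fun y => plus (f 1%nat y) (plus (f 2%nat y) (f 3%nat y)))).
- intros t. now rewrite sum_1_3.
- rewrite sum_1_3.
  apply (is_derive_plus (V := AbsRing_NormedModule K)); [apply H; lia|].
  apply (is_derive_plus (V := AbsRing_NormedModule K)); apply H; lia.
Qed.

Lemma locally_neq {T : UniformSpace} {K : AbsRing} (f : T -> K) (x : T) (v : K) :
  continuous f x -> f x <> v -> locally x (fun y => f y <> v).
Proof.
intros Hf Hv.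
assert (Hd : 0 < abs (minus v (f x))).
{ destruct (Rle_lt_or_eq_dec _ _ (abs_ge_0 (minus v (f x)))) as [H|H]; auto.
  exfalso. apply Hv. symmetry in H. apply abs_eq_zero in H.
  apply (plus_reg_r (opp (f x))). change (minus (f x) (f x) = minus v (f x)).
  rewrite H. exact (minus_eq_zero (G := K) (f x)). }
assert (Hb : locally x (fun y => ball (f x) (mkposreal _ Hd) (f y)))
  by exact (Hf _ (locally_ball (f x) (mkposreal _ Hd))).
revert Hb. apply filter_imp. intros y Hy E. change (abs (minus (f y) (f x)) < abs (minus v (f x))) in Hy.
rewrite E in Hy. lra.
Qed.

(** Near [x], continuity keeps [f] away from those of the three values that differ from [f x]. Three
    is the number of roots of the cubic satisfied by the fields. *)
Lemma continuous_finite_values {T : UniformSpace} {K : AbsRing}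
    (U : T -> Prop) (f : T -> K) (a b c : K) :
  open U -> connected U -> (forall x, U x -> continuous f x) ->
  (forall x, U x -> f x = a \/ f x = b \/ f x = c) ->
  forall x y, U x -> U y -> f y = f x.
Proof.
intros oU cU Hf Hv. apply (connected_locally_constant U f oU cU).
intros x Ux.
assert (away : forall v, locally x (fun y => f y = v -> f x = v)).
{ intros v. destruct (classic (f x = v)) as [E|E].
  - apply filter_forall. auto.
  - generalize (locally_neq f x v (Hf x Ux) E). apply filter_imp.
    intros y H H'. now elim H. }
generalize (filter_and _ _ (oU x Ux) (filter_and _ _ (away a)
  (filter_and _ _ (away b) (away c)))).
apply filter_imp. intros y [Uy [Ha [Hb Hc]]].
destruct (Hv y Uy) as [E|[E|E]]; rewrite E; symmetry; auto.
Qed.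

(** A trajectory is differentiable, hence continuous, at time 0, so it stays in [V] for small times.
    This allows differentiation along the flows inside the region where higher derivatives exist. *)
Lemma local_flow_restrict {K : AbsRing} (U V : K -> Prop) (X : K -> K)
    (E : K -> K -> K) :
  open V -> (forall x, V x -> U x) ->
  is_local_flow U X E -> is_local_flow V X E.
Proof.
intros oV VU HE x Vx. destruct (HE x (VU x Vx)) as [E0 HE'].
split; auto.
destruct (locally_singleton _ _ HE') as [_ D0].
assert (C0 : continuous (fun s => E s x) zero).
{ apply (ex_derive_continuous (V := AbsRing_NormedModule K)). eexists; exact D0. }
assert (HV : locally (zero : K) (fun t => V (E t x))).
{ apply C0. rewrite E0. now apply oV. }
generalize (filter_and _ _ HE' HV). apply filter_imp. tauto.
Qed.

Section Embedded.

(** The real and complex cases share one argument: [iota] sends algebraic identities to [C], where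
    the jet lemmas live, and analysis on [K] enters through two facts, uniqueness of the derivative
    and local constancy of functions with zero derivative. *)
Context {K : AbsRing} (iota : K -> C).
Context (iota_plus : forall x y, iota (plus x y) = (iota x + iota y)%C).
Context (iota_mult : forall x y, iota (mult x y) = (iota x * iota y)%C).
Context (iota_inj : forall x y, iota x = iota y -> x = y).
Context (derive_unique : forall (f : K -> K) (x l1 l2 : K),
  is_derive f x l1 -> is_derive f x l2 -> l1 = l2).
Context (derive_zero : forall (f : K -> K) (x : K),
  locally x (fun y => is_derive f y zero) -> locally x (fun y => f y = f x)).

Lemma iota_zero : iota zero = 0%C.
Proof.
assert (H := iota_plus zero zero). rewrite plus_zero_l in H.
transitivity ((iota zero + iota zero) - iota zero)%C; [ring|].
rewrite <- H. ring.
Qed.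

Lemma iota_opp (x : K) : iota (opp x) = (- iota x)%C.
Proof.
transitivity (iota (plus x (opp x)) - iota x)%C; [rewrite iota_plus; ring|].
replace (plus x (opp x)) with (zero : K) by exact (eq_sym (plus_opp_r (G := K) x)).
rewrite iota_zero. ring.
Qed.

Lemma mult_commutes (x y : K) : mult x y = mult y x.
Proof. apply iota_inj. rewrite !iota_mult. ring. Qed.

Lemma is_derive_mult_K (f g : K -> K) (x df dg : K) :
  is_derive f x df -> is_derive g x dg ->
  is_derive (fun y => mult (f y) (g y)) x (plus (mult df (g x)) (mult (f x) dg)).
Proof. intros Hf Hg. apply is_derive_mult; auto. exact mult_commutes. Qed.

Lemma derivative_of_zero_sum (F F' : nat -> K -> K) (x : K) :
  locally x (fun y => sum_n_m (fun k => F k y) 1 3 = zero) ->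
  (forall k, (1 <= k <= 3)%nat -> is_derive (F k) x (F' k x)) ->
  sum_n_m (fun k => F' k x) 1 3 = zero.
Proof.
intros H0 HF.
apply (derive_unique (fun y => sum_n_m (fun k => F k y) 1 3) x).
- now apply is_derive_sum_1_3.
- apply (is_derive_ext_loc (fun _ => zero)).
  + revert H0. apply filter_imp. auto.
  + apply (is_derive_const (V := AbsRing_NormedModule K)).
Qed.

(* Differentiating in the time variable replaces [F k] by its Lie derivative
   along [X k]. *)
Lemma barycentric_step (V : K -> Prop) (X F F' : nat -> K -> K)
    (E : nat -> K -> K -> K) :
  (forall k, (1 <= k <= 3)%nat -> is_local_flow V (X k) (E k)) ->
  (forall k x, (1 <= k <= 3)%nat -> V x -> is_derive (F k) x (F' k x)) ->
  forall x, V x ->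
  locally (zero : K) (fun t => sum_n_m (fun k => F k (E k t x)) 1 3 = zero) ->
  locally (zero : K)
    (fun t => sum_n_m (fun k => mult (X k (E k t x)) (F' k (E k t x))) 1 3 = zero).
Proof.
intros HE HF x Vx H0.
assert (fl : forall k, (1 <= k <= 3)%nat -> locally (zero : K) (fun t =>
  V (E k t x) /\ is_derive (fun s => E k s x) t (X k (E k t x)))).
{ intros k Hk. apply (HE k Hk x Vx). }
assert (f1 := fl 1%nat ltac:(lia)). assert (f2 := fl 2%nat ltac:(lia)).
assert (f3 := fl 3%nat ltac:(lia)). assert (f0 := locally_locally _ _ H0).
generalize (filter_and _ _ f0 (filter_and _ _ f1 (filter_and _ _ f2 f3))).
apply filter_imp. intros t [Ht [H1 [H2 H3]]].
apply (derivative_of_zero_sum (fun k t => F k (E k t x))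
  (fun k t => mult (X k (E k t x)) (F' k (E k t x)))); auto.
intros k Hk.
assert (Hk' : V (E k t x) /\ is_derive (fun s => E k s x) t (X k (E k t x))).
{ destruct k as [|[|[|[|k]]]]; auto; lia. }
destruct Hk' as [Vk Dk].
apply (is_derive_comp (V := AbsRing_NormedModule K) (F k) (fun s => E k s x)); auto.
Qed.

(** This is [q]; where it is nonzero, none of the three fields vanishes, so each flow can be
    inverted in time. *)
Definition product (X : nat -> K -> K) (x : K) : K :=
  mult (X 1%nat x) (mult (X 2%nat x) (X 3%nat x)).

Definition sum_squares (X : nat -> K -> K) (x : K) : K :=
  sum_n_m (fun k => mult (X k x) (X k x)) 1 3.

Lemma iota_product (X : nat -> K -> K) (x : K) :
  iota (product X x) =
  (iota (X 1%nat x) * iota (X 2%nat x) * iota (X 3%nat x))%C.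
Proof. unfold product. rewrite !iota_mult. ring. Qed.

Lemma iota_sum_squares (X : nat -> K -> K) (x : K) :
  iota (sum_squares X x) =
  (iota (X 1%nat x) * iota (X 1%nat x) + iota (X 2%nat x) * iota (X 2%nat x)
   + iota (X 3%nat x) * iota (X 3%nat x))%C.
Proof.
unfold sum_squares. rewrite sum_1_3, !iota_plus, !iota_mult. ring.
Qed.

Lemma iota_sum_zero (f : nat -> K) :
  sum_n_m f 1 3 = zero -> (iota (f 1%nat) + iota (f 2%nat) + iota (f 3%nat) = 0)%C.
Proof.
intros H. rewrite <- iota_zero, <- H, sum_1_3, !iota_plus. ring.
Qed.

Lemma product_derive (X Y : nat -> K -> K) (x : K) :
  (forall k, (1 <= k <= 3)%nat -> is_derive (X k) x (Y k x)) ->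
  is_derive (product X) x
    (plus (mult (Y 1%nat x) (mult (X 2%nat x) (X 3%nat x)))
      (mult (X 1%nat x) (plus (mult (Y 2%nat x) (X 3%nat x))
        (mult (X 2%nat x) (Y 3%nat x))))).
Proof.
intros H. unfold product.
apply (is_derive_mult_K (X 1%nat) (fun y => mult (X 2%nat y) (X 3%nat y)));
  [apply H; lia|].
apply (is_derive_mult_K (X 2%nat) (X 3%nat)); apply H; lia.
Qed.

(** A continuous function with constant square on a connected set is constant, so [q] is constant.
    With [sum X = 0] and the sum of squares, this fixes all the symmetric functions of the fields:
    every field takes its values among the three values at [x0], and continuity forbids jumps. *)
Lemma constant_of_product_square (U : K -> Prop) (X : nat -> K -> K) :
  open U -> connected U ->
  (forall k x, (1 <= k <= 3)%nat -> U x -> continuous (X k) x) ->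
  (forall k l, (1 <= k <= 3)%nat -> (1 <= l <= 3)%nat -> k <> l ->
     exists x, U x /\ X k x <> X l x) ->
  (forall x, U x -> continuous (product X) x) ->
  (forall x, U x -> sum_n_m (fun k => X k x) 1 3 = zero) ->
  (forall x y, U x -> U y -> sum_squares X y = sum_squares X x) ->
  (forall x y, U x -> U y ->
     mult (product X y) (product X y) = mult (product X x) (product X x)) ->
  constant_fields 3 U X.
Proof.
intros oU cU HX Hd Hq S0 Hc Hqq.
destruct (Hd 1%nat 2%nat) as [x0 [Ux0 _]]; try lia.
assert (Hq0 : forall x, U x -> product X x = product X x0).
{ intros x Ux.
  (* Only two values, [q x0] and its opposite, are possible; the third slot repeats the first. *)
  apply (continuous_finite_values U (product X) (product X x0)
    (opp (product X x0)) (product X x0)); auto.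
  intros y Uy.
  assert (H := f_equal iota (Hqq x0 y Ux0 Uy)). rewrite !iota_mult in H.
  assert (H' : ((iota (product X y) - iota (product X x0))
     * (iota (product X y) + iota (product X x0)) = 0)%C).
  { transitivity (iota (product X y) * iota (product X y)
       - iota (product X x0) * iota (product X x0))%C; [ring|]. rewrite H; ring. }
  destruct (Cmult_eq_0 _ _ H') as [H1|H1].
  - left. apply iota_inj. now apply Ceq_minus.
  - right; left. apply iota_inj. rewrite iota_opp. apply Ceq_minus.
    rewrite <- H1. ring. }
assert (Hroot : forall k x, (1 <= k <= 3)%nat -> U x ->
   X k x = X 1%nat x0 \/ X k x = X 2%nat x0 \/ X k x = X 3%nat x0).
{ intros k x Hk Ux.
  assert (P := f_equal iota (Hq0 x Ux)). rewrite !iota_product in P.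
  assert (Q := f_equal iota (Hc x0 x Ux0 Ux)). rewrite !iota_sum_squares in Q.
  assert (S := iota_sum_zero _ (S0 x Ux)). assert (T := iota_sum_zero _ (S0 x0 Ux0)).
  cbv beta in S, T.
  (* Both triples have the same elementary symmetric functions. *)
  assert (R : forall x1 x2 x3 a b c v : C,
    (x1 * x2 * x3 = a * b * c)%C ->
    (x1 * x1 + x2 * x2 + x3 * x3 = a * a + b * b + c * c)%C ->
    (x1 + x2 + x3 = 0)%C -> (a + b + c = 0)%C ->
    ((v - x1) * (v - x2) * (v - x3) = 0)%C -> v = a \/ v = b \/ v = c).
  { clear. intros x1 x2 x3 a b c v P Q S T H.
    assert (H' : (2 * ((v - a) * ((v - b) * (v - c))) = 0)%C).
    { transitivity (2 * ((v - x1) * (v - x2) * (v - x3)))%C;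
        [|rewrite H; ring].
      transitivity (2 * v ^ 3 - 2 * v ^ 2 * (a + b + c)
        + v * ((a + b + c) ^ 2 - (a * a + b * b + c * c)) - 2 * (a * b * c))%C;
        [ring|].
      rewrite T, <- Q, <- P.
      replace x3 with ((x1 + x2 + x3) - x1 - x2)%C by ring. rewrite S. ring. }
    destruct (Cmult_eq_0 _ _ H') as [H1|H1].
    - now apply (Cnonzero_num 2) in H1.
    - destruct (Cmult_eq_0 _ _ H1) as [H2|H2]; [left; now apply Ceq_minus|].
      destruct (Cmult_eq_0 _ _ H2) as [H3|H3];
        [right; left|right; right]; now apply Ceq_minus. }
  destruct (R _ _ _ _ _ _ (iota (X k x)) P Q S T) as [H|[H|H]];
    [|left|right; left|right; right]; try (apply iota_inj; exact H).
  destruct k as [|[|[|[|k]]]]; try lia; ring. }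
exists (fun k => X k x0). split.
- intros k Hk x Ux.
  apply (continuous_finite_values U (X k) (X 1%nat x0) (X 2%nat x0) (X 3%nat x0));
    auto.
- intros k l Hk Hl kl H. destruct (Hd k l Hk Hl kl) as [x [Ux Hx]].
  apply Hx.
  transitivity (X k x0); [|rewrite H; symmetry].
  1: symmetry; symmetry.
  all: apply (continuous_finite_values U (X _) (X 1%nat x0) (X 2%nat x0) (X 3%nat x0));
    auto.
Qed.

(** [Y], [Z], [W] are the successive derivatives of [X], the last two meaningful only where
    [product X] is nonzero. The second alternative is the isotropic one: its final equation says
    that the square of each of the first two fields has zero second derivative off the zeros of
    [q]. *)
Lemma chambar_rigidity (U : K -> Prop) (X Y Z W : nat -> K -> K) :
  open U -> connected U ->
  (forall k x, (1 <= k <= 3)%nat -> U x -> is_derive (X k) x (Y k x)) ->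
  (forall k x, (1 <= k <= 3)%nat -> U x -> product X x <> zero ->
     is_derive (Y k) x (Z k x) /\ is_derive (Z k) x (W k x)) ->
  (forall k l, (1 <= k <= 3)%nat -> (1 <= l <= 3)%nat -> k <> l ->
     exists x, U x /\ X k x <> X l x) ->
  barycentric 3 U X ->
  (forall x, U x -> sum_n_m (fun k => X k x) 1 3 = zero) /\
  (constant_fields 3 U X \/
   forall x, U x -> sum_squares X x = zero /\
     (product X x <> zero -> forall k, (1 <= k <= 2)%nat ->
        plus (mult (Y k x) (Y k x)) (mult (X k x) (Z k x)) = zero)).
Proof.
intros oU cU DX DYZ Hd [E [HE Hbar]].
assert (CX : forall k x, (1 <= k <= 3)%nat -> U x -> continuous (X k) x).
{ intros k x Hk Ux. apply (ex_derive_continuous (V := AbsRing_NormedModule K)).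
  eexists; now apply DX. }
assert (DP : forall x, U x -> ex_derive (product X) x).
{ intros x Ux. eexists. apply (product_derive X Y). intros; now apply DX. }
assert (CP : forall x, U x -> continuous (product X) x).
{ intros x Ux. apply (ex_derive_continuous (V := AbsRing_NormedModule K)). now apply DP. }
set (V := fun x => U x /\ product X x <> zero).
assert (oV : open V).
{ intros x [Ux Hx]. generalize (filter_and _ _ (oU x Ux)
    (locally_neq _ x zero (CP x Ux) Hx)). apply filter_imp. auto. }
assert (VU : forall x, V x -> U x) by (intros x [H _]; exact H).
assert (HEV : forall k, (1 <= k <= 3)%nat -> is_local_flow V (X k) (E k)).
{ intros k Hk. apply (local_flow_restrict U); auto. }
(* [F1], [F2], [F3] are the iterated Lie derivatives of each field along itself; [G1] and [G2] are
   the space derivatives of [F1] and [F2], and [H1] that of [G1]. *)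
pose (F1 := fun k x => mult (X k x) (Y k x)).
pose (G1 := fun k x => plus (mult (Y k x) (Y k x)) (mult (X k x) (Z k x))).
pose (H1 := fun k x => plus (plus (mult (Z k x) (Y k x)) (mult (Y k x) (Z k x)))
   (plus (mult (Y k x) (Z k x)) (mult (X k x) (W k x)))).
pose (F2 := fun k x => mult (X k x) (G1 k x)).
pose (G2 := fun k x => plus (mult (Y k x) (G1 k x)) (mult (X k x) (H1 k x))).
pose (F3 := fun k x => mult (X k x) (G2 k x)).
(* This level needs first derivatives only, so it holds on all of [U] and makes the sum of squares
   constant there, zeros of [q] included. The next two levels live on [V]. *)
assert (B1 : forall x, U x -> locally (zero : K)
   (fun t => sum_n_m (fun k => F1 k (E k t x)) 1 3 = zero)).
{ intros x Ux. apply (barycentric_step U X X Y E HE); auto. }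
assert (DF1 : forall k x, (1 <= k <= 3)%nat -> V x -> is_derive (F1 k) x (G1 k x)).
{ intros k x Hk Vx. apply (is_derive_mult_K (X k) (Y k)); auto.
  now apply DYZ; try apply Vx. }
assert (DG1 : forall k x, (1 <= k <= 3)%nat -> V x -> is_derive (G1 k) x (H1 k x)).
{ intros k x Hk [Ux Px]. destruct (DYZ k x Hk Ux Px) as [D1 D2].
  apply (is_derive_plus (V := AbsRing_NormedModule K)).
  - now apply (is_derive_mult_K (Y k) (Y k)).
  - apply (is_derive_mult_K (X k) (Z k)); auto. }
assert (DF2 : forall k x, (1 <= k <= 3)%nat -> V x -> is_derive (F2 k) x (G2 k x)).
{ intros k x Hk Vx. apply (is_derive_mult_K (X k) (G1 k)); auto. }
assert (B2 : forall x, V x -> locally (zero : K)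
   (fun t => sum_n_m (fun k => F2 k (E k t x)) 1 3 = zero)).
{ intros x Vx. apply (barycentric_step V X F1 G1 E HEV); auto. }
assert (B3 : forall x, V x -> locally (zero : K)
   (fun t => sum_n_m (fun k => F3 k (E k t x)) 1 3 = zero)).
{ intros x Vx. apply (barycentric_step V X F2 G2 E HEV); auto. }
assert (at0 : forall (F : nat -> K -> K) x, U x -> locally (zero : K)
   (fun t => sum_n_m (fun k => F k (E k t x)) 1 3 = zero) ->
   sum_n_m (fun k => F k x) 1 3 = zero).
{ intros F x Ux H. apply locally_singleton in H. rewrite <- H.
  apply sum_n_m_ext_loc. intros k Hk. now rewrite (proj1 (HE k Hk x Ux)). }
assert (S0 : forall x, U x -> sum_n_m (fun k => X k x) 1 3 = zero)
  by (intros x Ux; apply (at0 X); auto).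
assert (SF1 : forall x, U x -> sum_n_m (fun k => F1 k x) 1 3 = zero)
  by (intros x Ux; apply (at0 F1); auto).
assert (SY : forall x, U x -> sum_n_m (fun k => Y k x) 1 3 = zero).
{ intros x Ux. apply (derivative_of_zero_sum X Y); auto.
  generalize (oU x Ux). apply filter_imp. auto. }
assert (SZ : forall x, V x -> sum_n_m (fun k => Z k x) 1 3 = zero).
{ intros x Vx. apply (derivative_of_zero_sum Y Z); auto.
  - generalize (oV x Vx). apply filter_imp. auto.
  - intros k Hk. apply DYZ; auto; apply Vx. }
assert (SW : forall x, V x -> sum_n_m (fun k => W k x) 1 3 = zero).
{ intros x Vx. apply (derivative_of_zero_sum Z W); auto.
  - generalize (oV x Vx). apply filter_imp. auto.
  - intros k Hk. apply DYZ; auto; apply Vx. }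
assert (SG1 : forall x, V x -> sum_n_m (fun k => G1 k x) 1 3 = zero).
{ intros x Vx. apply (derivative_of_zero_sum F1 G1); auto.
  generalize (oV x Vx). apply filter_imp. auto. }
assert (SH1 : forall x, V x -> sum_n_m (fun k => H1 k x) 1 3 = zero).
{ intros x Vx. apply (derivative_of_zero_sum G1 H1); auto.
  generalize (oV x Vx). apply filter_imp. auto. }
assert (SF2 : forall x, V x -> sum_n_m (fun k => F2 k x) 1 3 = zero)
  by (intros x Vx; apply (at0 F2); auto).
assert (SF3 : forall x, V x -> sum_n_m (fun k => F3 k x) 1 3 = zero)
  by (intros x Vx; apply (at0 F3); auto).
split; auto.
assert (Hc : forall x y, U x -> U y -> sum_squares X y = sum_squares X x).
{ apply (connected_locally_constant U _ oU cU). intros x Ux.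
  apply derive_zero. generalize (oU x Ux). apply filter_imp. intros y Uy.
  assert (Es : sum_n_m (fun k => plus (mult (Y k y) (X k y)) (mult (X k y) (Y k y))) 1 3
     = zero).
  { apply iota_inj. transitivity (RtoC 0); [|symmetry; exact iota_zero].
    rewrite sum_1_3, !iota_plus, !iota_mult.
    assert (H := iota_sum_zero _ (SF1 y Uy)). unfold F1 in H.
    rewrite !iota_mult in H.
    match type of H with ?a = _ => transitivity (2 * a)%C; [ring | rewrite H; ring] end. }
  assert (D : is_derive (sum_squares X) y
    (sum_n_m (fun k => plus (mult (Y k y) (X k y)) (mult (X k y) (Y k y))) 1 3)).
  { apply (is_derive_sum_1_3 (fun k z => mult (X k z) (X k z))).
    intros k Hk. apply is_derive_mult_K; auto. }
  rewrite Es in D. exact D. }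
destruct (classic (exists x, U x /\ sum_squares X x <> zero)) as [[x0 [Ux0 Hx0]]|Hno].
- left. apply constant_of_product_square; auto.
  apply (connected_locally_constant U (fun x => mult (product X x) (product X x)) oU cU).
  intros x Ux.
  apply (derive_zero (fun x => mult (product X x) (product X x))).
  generalize (oU x Ux). apply filter_imp. intros y Uy.
  assert (Hcy : iota (sum_squares X y) <> 0%C).
  { rewrite <- iota_zero. intros H. apply iota_inj in H. apply Hx0.
    rewrite <- H. now apply Hc. }
  rewrite iota_sum_squares in Hcy.
  assert (D := product_derive X Y y ltac:(intros; now apply DX)).
  assert (D2 := is_derive_mult_K _ _ _ _ _ D D).
  match type of D2 with is_derive _ _ ?l =>
    assert (El : l = zero); [|rewrite El in D2; exact D2] end.
  clear D2. apply iota_inj. transitivity (RtoC 0); [|symmetry; exact iota_zero].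
  (* The derivative of [q^2] has the factor [q], which settles the zeros of [q]; elsewhere the jets
     force all three first derivatives to vanish. *)
  destruct (classic (product X y = zero)) as [Hq|Hq].
  + rewrite iota_plus, (iota_mult _ (product X y)), (iota_mult (product X y)), Hq.
    rewrite iota_zero. ring.
  + assert (Vy : V y) by (split; auto).
    assert (Hq' : (iota (X 1%nat y) * iota (X 2%nat y) * iota (X 3%nat y) <> 0)%C).
    { rewrite <- iota_product. intros H. apply Hq. apply iota_inj.
      now rewrite iota_zero. }
    assert (A0 := iota_sum_zero _ (S0 y Uy)). assert (A1 := iota_sum_zero _ (SY y Uy)).
    assert (A2 := iota_sum_zero _ (SZ y Vy)). assert (A3 := iota_sum_zero _ (SW y Vy)).
    assert (A4 := iota_sum_zero _ (SF1 y Uy)). assert (A5 := iota_sum_zero _ (SG1 y Vy)).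
    assert (A6 := iota_sum_zero _ (SH1 y Vy)). assert (A7 := iota_sum_zero _ (SF2 y Vy)).
    assert (A8 := iota_sum_zero _ (SF3 y Vy)).
    unfold F3, G2, F2, H1, G1, F1 in *. cbv beta in *.
    repeat (rewrite iota_plus in A5 || rewrite iota_plus in A6 || rewrite iota_plus in A7
      || rewrite iota_plus in A8 || rewrite iota_mult in A4 || rewrite iota_mult in A5
      || rewrite iota_mult in A6 || rewrite iota_mult in A7 || rewrite iota_mult in A8).
    destruct (jet_rigid _ _ _ _ _ _ _ _ _ _ _ _ A0 A1 A2 A3 A4 A5
      ltac:(rewrite <- A6; ring) ltac:(rewrite <- A7; ring) ltac:(rewrite <- A8; ring)
      Hcy Hq') as [Y1 [Y2 Y3]].
    rewrite ?iota_plus, ?iota_mult, ?iota_plus, ?iota_mult, ?iota_plus, ?iota_mult.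
    rewrite Y1, Y2, Y3. ring.
- right. intros x Ux.
  assert (Hcx : sum_squares X x = zero).
  { destruct (classic (sum_squares X x = zero)) as [|H]; auto.
    exfalso; apply Hno; eauto. }
  split; auto. intros Hq k Hk.
  assert (Vx : V x) by (split; auto).
  assert (Hq' : (iota (X 1%nat x) * iota (X 2%nat x) * iota (X 3%nat x) <> 0)%C).
  { rewrite <- iota_product. intros H. apply Hq. apply iota_inj.
    now rewrite iota_zero. }
  assert (A := f_equal iota Hcx). rewrite iota_sum_squares, iota_zero in A.
  assert (A0 := iota_sum_zero _ (S0 x Ux)). assert (A1 := iota_sum_zero _ (SY x Ux)).
  assert (A2 := iota_sum_zero _ (SZ x Vx)).
  assert (A4 := iota_sum_zero _ (SF1 x Ux)). assert (A5 := iota_sum_zero _ (SG1 x Vx)).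
  assert (A7 := iota_sum_zero _ (SF2 x Vx)).
  unfold F2, G1, F1 in *. cbv beta in *.
  repeat (rewrite iota_plus in A5 || rewrite iota_plus in A7 || rewrite iota_mult in A4
    || rewrite iota_mult in A5 || rewrite iota_mult in A7).
  destruct (jet_isotropic _ _ _ _ _ _ _ _ _ A0 A1 A2 A4 A5
      ltac:(rewrite <- A7; ring) A Hq') as [B B'].
  apply iota_inj. transitivity (RtoC 0); [|symmetry; exact iota_zero].
  rewrite iota_plus, !iota_mult.
  destruct k as [|[|[|k]]]; try lia; assumption.
Qed.

End Embedded.

(** * The real case *)

Lemma real_derive_zero (f : R -> R) (x : R) :
  locally x (fun y => is_derive f y 0) -> locally x (fun y => f y = f x).
Proof.
intros [d Hd]. exists d. intros y Hy.
assert (Hin : forall z, Rmin x y <= z <= Rmax x y -> is_derive f z 0).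
{ intros z Hz. apply Hd. change (Rabs (z - x) < d).
  change (Rabs (y - x) < d) in Hy. revert Hz Hy.
  unfold Rmin, Rmax, Rabs. destruct (Rle_dec x y);
    destruct (Rcase_abs (z - x)); destruct (Rcase_abs (y - x)); lra. }
destruct (MVT_gen f x y (fun _ => 0)) as [c [_ Hc]].
- intros z Hz. apply Hin. lra.
- intros z Hz. apply continuity_pt_filterlim.
  apply (ex_derive_continuous (V := R_NormedModule)). eexists; now apply Hin.
- lra.
Qed.

Lemma is_pseries_CV_radius (a : nat -> R) (x l : R) :
  is_pseries a x l -> Rbar_le (Rabs x) (CV_radius a).
Proof.
intros H. apply Rbar_not_lt_le. intros H'. apply (CV_disk_outside a x H').
apply is_pseries_R in H.
apply (ex_series_lim_0 (fun n => a n * x ^ n)). now exists l.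
Qed.

(** Around each centre the derivative is the sum of the termwise differentiated series, which has
    the same radius of convergence. Iterating this provides the three derivatives in the real
    case. *)
Lemma real_analytic_derive (U : R -> Prop) (f : R -> R) :
  real_analytic_on U f ->
  real_analytic_on U (Derive f) /\ forall x, U x -> is_derive f x (Derive f x).
Proof.
intros Hf.
assert (key : forall x0, U x0 -> exists a : nat -> R,
  locally x0 (fun x => is_derive f x (PSeries (PS_derive a) (x - x0)) /\
    is_pseries (PS_derive a) (x - x0) (PSeries (PS_derive a) (x - x0)))).
{ intros x0 Ux0. destruct (Hf x0 Ux0) as [a [d Hd]]. exists a.
  (* Convergence at the single point [x0 + d / 2] of the given ball bounds the radius of convergence
     from below by [d / 2]; the termwise derivative is then available at distance strictly less than
     [d / 2]. *)
  assert (Hr : Rbar_le (d / 2) (CV_radius a)).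
  { assert (Hp : 0 < d / 2) by (generalize (cond_pos d); lra).
    rewrite <- (Rabs_pos_eq (d / 2)) by lra.
    apply (is_pseries_CV_radius a (d / 2) (f (x0 + d / 2))).
    replace (d / 2) with (x0 + d / 2 - x0) at 1 by ring. apply Hd.
    change (Rabs (x0 + d / 2 - x0) < d).
    replace (x0 + d / 2 - x0) with (d / 2) by ring. rewrite Rabs_pos_eq; lra. }
  assert (Hp : 0 < d / 2) by (generalize (cond_pos d); lra).
  exists (mkposreal _ Hp). intros x Hx. change (Rabs (x - x0) < d / 2) in Hx.
  assert (Hx' : Rbar_lt (Rabs (x - x0)) (CV_radius a))
    by (apply Rbar_lt_le_trans with (2 := Hr); exact Hx).
  split.
  - apply (is_derive_ext_loc (fun y => PSeries a (y - x0))).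
    + assert (Hq : 0 < d / 2 - Rabs (x - x0)) by lra.
      exists (mkposreal _ Hq). intros y Hy.
      change (Rabs (y - x) < d / 2 - Rabs (x - x0)) in Hy.
      apply is_pseries_unique. apply Hd. change (Rabs (y - x0) < d).
      replace (y - x0) with ((y - x) + (x - x0)) by ring.
      generalize (Rabs_triang (y - x) (x - x0)). lra.
    + rewrite <- (scal_one (PSeries _ _)).
      apply (is_derive_comp (V := R_NormedModule) (PSeries a) (fun y => y - x0)).
      * now apply is_derive_PSeries.
      * assert (D : is_derive (fun y : R => y - x0) x 1)
          by (auto_derive; [auto | ring]).
        exact D.
  - apply PSeries_correct. apply CV_radius_inside. now rewrite CV_radius_derive. }
split.
- intros x0 Ux0. destruct (key x0 Ux0) as [a Ha]. exists (PS_derive a).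
  revert Ha. apply filter_imp. intros x [D P].
  now rewrite (is_derive_unique _ _ _ D).
- intros x0 Ux0. destruct (key x0 Ux0) as [a Ha].
  apply Derive_correct. eexists. exact (proj1 (locally_singleton _ _ Ha)).
Qed.

Lemma real_3_chambar_constant (U : R -> Prop) (X : nat -> R -> R) :
  open U -> connected U -> real_chambar 3 U X -> constant_fields 3 U X.
Proof.
intros oU cU [Han [Hnz [Hd Hbar]]].
assert (A1 : forall k, (1 <= k <= 3)%nat -> real_analytic_on U (Derive (X k)))
  by (intros k Hk; apply real_analytic_derive; auto).
assert (A2 : forall k, (1 <= k <= 3)%nat -> real_analytic_on U (Derive (Derive (X k))))
  by (intros k Hk; apply real_analytic_derive; auto).
destruct (@chambar_rigidity R_AbsRing RtoC RtoC_plus RtoC_mult RtoC_inj) with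
  (U := U) (X := X) (Y := fun k => Derive (X k)) (Z := fun k => Derive (Derive (X k)))
  (W := fun k => Derive (Derive (Derive (X k)))) as [S0 [H|H]]; auto.
- intros f x l1 l2 H1 H2.
  rewrite <- (is_derive_unique f x l1 H1). exact (is_derive_unique f x l2 H2).
- exact real_derive_zero.
- intros k x Hk Ux. apply (real_analytic_derive U (X k)); auto.
- intros k x Hk Ux _. split.
  + now apply (real_analytic_derive U (Derive (X k)) (A1 k Hk)).
  + now apply (real_analytic_derive U (Derive (Derive (X k))) (A2 k Hk)).
- exfalso. destruct (Hnz 1%nat ltac:(lia)) as [x [Ux Hx]]. apply Hx.
  destruct (H x Ux) as [Hs _]. unfold sum_squares in Hs. rewrite sum_1_3 in Hs.
  change (X 1%nat x * X 1%nat x + (X 2%nat x * X 2%nat x + X 3%nat x * X 3%nat x) = 0)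
    in Hs.
  change (X 1%nat x = 0). nra.
Qed.

(** * Complex differentiability *)

(** [C] carries two uniform structures with the same open sets: the one of the modulus, on which
    complex derivatives are built, and the one of the product of two real lines, used by [open] and
    [connected] in the theorem. [Cspace] is the former. *)
Notation Cspace := (AbsRing_UniformSpace C_AbsRing).
Definition is_Cderive (f : C -> C) (z l : C) : Prop :=
  @is_derive C_AbsRing (AbsRing_NormedModule C_AbsRing) f z l.

Lemma locally_Cmod (z : C) (P : C -> Prop) :
  @locally Cspace z P <->
  exists d : R, 0 < d /\ forall w, Cmod (w - z) < d -> P w.
Proof.
split.
- intros [d Hd]. exists d. split; [apply cond_pos|]. intros w Hw. now apply Hd.
- intros [d [Hd H]]. exists (mkposreal _ Hd). intros w Hw. apply H. exact Hw.
Qed.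

Lemma is_Cderive_iff (f : C -> C) (z l : C) :
  is_Cderive f z l <->
  forall eps : R, 0 < eps -> exists d : R, 0 < d /\ forall w, Cmod (w - z) < d ->
    Cmod (f w - f z - l * (w - z)) <= eps * Cmod (w - z).
Proof.
split.
- intros [_ H] eps Heps. apply locally_Cmod.
  generalize (H z (fun P HP => HP) (mkposreal _ Heps)). apply filter_imp.
  intros w Hw.
  replace (f w - f z - l * (w - z))%C with (f w - f z - (w - z) * l)%C by ring.
  exact Hw.
- intros H. split; [apply is_linear_scal_l|].
  intros y Hy.
  apply (is_filter_lim_locally_unique (V := AbsRing_NormedModule C_AbsRing)) in Hy.
  rewrite <- Hy. clear y Hy. intros eps. assert (H' := proj2 (locally_Cmod _ _) (H eps (cond_pos eps))).
  revert H'. apply filter_imp. intros w Hw.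
  replace (f w - f z - l * (w - z))%C with (f w - f z - (w - z) * l)%C in Hw by ring.
  exact Hw.
Qed.

Lemma is_Cderive_C_derive (f : C -> C) (z l : C) :
  is_Cderive f z l -> C_derive f z = l.
Proof.
intros [[L0 L1 L2] H]. apply is_C_derive_unique.
split; [split; [exact L0 | exact L1 | exact L2] | exact H].
Qed.

Lemma is_Cderive_unique (f : C -> C) (z l1 l2 : C) :
  is_Cderive f z l1 -> is_Cderive f z l2 -> l1 = l2.
Proof.
intros H1 H2.
rewrite <- (is_Cderive_C_derive f z l1 H1). exact (is_Cderive_C_derive f z l2 H2).
Qed.

Lemma C_derive_is_Cderive (f : C -> C) (z l : C) :
  is_Cderive f z l -> is_Cderive f z (C_derive f z).
Proof. intros H. now rewrite (is_Cderive_C_derive f z l H). Qed.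

Lemma is_Cderive_continuous (f : C -> C) (z l : C) :
  is_Cderive f z l -> @continuous Cspace Cspace f z.
Proof.
intros H. apply (ex_derive_continuous (V := AbsRing_NormedModule C_AbsRing)).
now exists l.
Qed.

Lemma is_Cderive_const (a z : C) : is_Cderive (fun _ => a) z 0%C.
Proof. apply (is_derive_const (V := AbsRing_NormedModule C_AbsRing)). Qed.

Lemma is_Cderive_id (z : C) : is_Cderive (fun w => w) z 1%C.
Proof. apply (is_derive_id (K := C_AbsRing)). Qed.

Lemma is_Cderive_plus (f g : C -> C) (z df dg : C) :
  is_Cderive f z df -> is_Cderive g z dg ->
  is_Cderive (fun w => f w + g w)%C z (df + dg)%C.
Proof. apply (is_derive_plus (V := AbsRing_NormedModule C_AbsRing)). Qed.

Lemma is_Cderive_minus (f g : C -> C) (z df dg : C) :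
  is_Cderive f z df -> is_Cderive g z dg ->
  is_Cderive (fun w => f w - g w)%C z (df - dg)%C.
Proof. apply (is_derive_minus (V := AbsRing_NormedModule C_AbsRing)). Qed.

Lemma is_Cderive_mult (f g : C -> C) (z df dg : C) :
  is_Cderive f z df -> is_Cderive g z dg ->
  is_Cderive (fun w => f w * g w)%C z (df * g z + f z * dg)%C.
Proof.
intros Hf Hg. apply (is_derive_mult (K := C_AbsRing)); auto. exact Cmult_comm.
Qed.

Lemma is_Cderive_comp (f g : C -> C) (z df dg : C) :
  is_Cderive f (g z) df -> is_Cderive g z dg ->
  is_Cderive (fun w => f (g w)) z (dg * df)%C.
Proof. apply (is_derive_comp (V := AbsRing_NormedModule C_AbsRing)). Qed.

Lemma Cmod_minus_sym (z w : C) : Cmod (z - w) = Cmod (w - z).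
Proof. rewrite <- Cmod_opp. f_equal. ring. Qed.

Lemma Cmod_triangle_minus (a b : C) : Cmod a - Cmod b <= Cmod (a - b).
Proof.
generalize (Cmod_triangle (a - b) b). replace (a - b + b)%C with a by ring. lra.
Qed.

Lemma is_Cderive_inv_id (z : C) : z <> 0%C ->
  is_Cderive Cinv z (- / (z * z))%C.
Proof.
intros Hz. assert (Hm := proj1 (Cmod_gt_0 z) Hz). apply is_Cderive_iff. intros eps Heps.
set (m := Cmod z) in *.
(* The remainder is [(w - z)^2 / (z^2 w)]: the first bound gives [|w| >= m / 2], the second then
   makes [|w - z| / (m^2 |w|)] at most [eps]. *)
exists (Rmin (m / 2) (eps * m ^ 3 / 2)). split.
- apply Rmin_pos; [lra|]. assert (0 < m ^ 3) by (apply pow_lt; lra). nra.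
- intros w Hw.
  assert (H1 := Rlt_le_trans _ _ _ Hw (Rmin_l _ _)).
  assert (H2 := Rlt_le_trans _ _ _ Hw (Rmin_r _ _)).
  assert (Hmw : m / 2 <= Cmod w).
  { generalize (Cmod_triangle_minus z w). rewrite Cmod_minus_sym. fold m. lra. }
  assert (Hw0 : w <> 0%C) by (apply Cmod_gt_0; lra).
  replace (/ w - / z - - / (z * z) * (w - z))%C
    with ((w - z) * ((w - z) * / (z * z * w)))%C by (field; auto).
  rewrite !Cmod_mult, Cmod_inv, !Cmod_mult by (repeat apply Cmult_neq_0; auto).
  rewrite (Rmult_comm eps).
  apply Rmult_le_compat_l; [apply Cmod_ge_0|]. fold m.
  apply Rmult_le_reg_r with (m * m * Cmod w); [repeat apply Rmult_lt_0_compat; lra|].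
  rewrite Rmult_assoc, Rinv_l by (apply Rgt_not_eq; repeat apply Rmult_lt_0_compat; lra).
  assert (H3 : eps * (m * m * (m / 2)) <= eps * (m * m * Cmod w)).
  { apply Rmult_le_compat_l; [lra|]. apply Rmult_le_compat_l; [nra|lra]. }
  nra.
Qed.

Lemma is_Cderive_inv (f : C -> C) (z df : C) : f z <> 0%C ->
  is_Cderive f z df ->
  is_Cderive (fun w => / f w)%C z (- df / (f z * f z))%C.
Proof.
intros Hz Hf.
replace (- df / (f z * f z))%C with (df * - / (f z * f z))%C by (field; auto).
apply (is_Cderive_comp Cinv); auto. now apply is_Cderive_inv_id.
Qed.

Lemma Cmod_le_sum (z : C) : Cmod z <= Rabs (Re z) + Rabs (Im z).
Proof.
rewrite <- (Rabs_pos_eq (Cmod z)) by apply Cmod_ge_0.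
assert (H : 0 <= Rabs (Re z) + Rabs (Im z))
  by (generalize (Rabs_pos (Re z)) (Rabs_pos (Im z)); lra).
rewrite <- (Rabs_pos_eq (Rabs (Re z) + Rabs (Im z)) H). apply Rsqr_le_abs_0.
unfold Rsqr.
replace (Cmod z * Cmod z) with (Cmod z ^ 2) by ring. rewrite Cmod2_alt.
generalize (Rabs_pos (Re z)) (Rabs_pos (Im z)) (pow2_abs (Re z)) (pow2_abs (Im z)).
nra.
Qed.

Lemma im_le_Cmod (z : C) : Rabs (Im z) <= Cmod z.
Proof.
replace (Im z) with (Re (- Ci * z)%C) by (destruct z; unfold Re, Im; simpl; ring).
eapply Rle_trans; [apply re_le_Cmod|]. rewrite Cmod_mult, Cmod_opp, Cmod_Ci. lra.
Qed.

Lemma continuous_C_pair {T : UniformSpace} (g : T -> C) (t : T) :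
  continuous (fun s => Re (g s)) t -> continuous (fun s => Im (g s)) t ->
  @continuous T Cspace g t.
Proof.
intros H1 H2 P HP. apply locally_Cmod in HP. destruct HP as [d [Hd HP]].
assert (Hp : 0 < d / 2) by lra.
assert (H1' : locally t (fun s => ball (Re (g t)) (mkposreal _ Hp) (Re (g s))))
  by exact (H1 _ (locally_ball (Re (g t)) (mkposreal _ Hp))).
assert (H2' : locally t (fun s => ball (Im (g t)) (mkposreal _ Hp) (Im (g s))))
  by exact (H2 _ (locally_ball (Im (g t)) (mkposreal _ Hp))).
change (locally t (fun s => P (g s))).
generalize (filter_and _ _ H1' H2'). apply filter_imp. intros s [A B].
apply HP. change (Rabs (Re (g s) - Re (g t)) < d / 2) in A.
change (Rabs (Im (g s) - Im (g t)) < d / 2) in B.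
eapply Rle_lt_trans; [apply Cmod_le_sum|].
replace (Re (g s - g t)) with (Re (g s) - Re (g t)) by (unfold Re; simpl; ring).
replace (Im (g s - g t)) with (Im (g s) - Im (g t)) by (unfold Im; simpl; ring).
lra.
Qed.

Lemma continuous_Re (z : C) : @continuous Cspace R_UniformSpace Re z.
Proof.
intros P [d HP]. change (@locally Cspace z (fun w => P (Re w))).
apply locally_Cmod. exists d. split; [apply cond_pos|].
intros w Hw. apply HP. change (Rabs (Re w - Re z) < d).
eapply Rle_lt_trans; [|exact Hw].
replace (Re w - Re z) with (Re (w - z)) by (unfold Re; simpl; ring).
apply re_le_Cmod.
Qed.

Lemma continuous_Im (z : C) : @continuous Cspace R_UniformSpace Im z.
Proof.
intros P [d HP]. change (@locally Cspace z (fun w => P (Im w))).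
apply locally_Cmod. exists d. split; [apply cond_pos|].
intros w Hw. apply HP. change (Rabs (Im w - Im z) < d).
eapply Rle_lt_trans; [|exact Hw].
replace (Im w - Im z) with (Im (w - z)) by (unfold Im; simpl; ring).
apply im_le_Cmod.
Qed.

(** * Differentiation along real paths and the mean value inequality *)

Lemma is_derive_R_iff (f : R -> R) (x l : R) :
  is_derive f x l <->
  forall eps : R, 0 < eps -> exists d : R, 0 < d /\ forall y, Rabs (y - x) < d ->
    Rabs (f y - f x - l * (y - x)) <= eps * Rabs (y - x).
Proof.
split.
- intros [_ H] eps Heps.
  destruct (H x (fun P HP => HP) (mkposreal _ Heps)) as [d Hd].
  exists d. split; [apply cond_pos|]. intros y Hy.
  rewrite (Rmult_comm l). now apply (Hd y).
- intros H. split; [apply is_linear_scal_l|].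
  intros y Hy.
  apply (is_filter_lim_locally_unique (V := R_NormedModule)) in Hy.
  rewrite <- Hy. clear y Hy. intros eps. destruct (H eps (cond_pos eps)) as [d [Hd Hd']].
  exists (mkposreal _ Hd). intros y Hy.
  assert (A := Hd' y Hy). rewrite (Rmult_comm l) in A. exact A.
Qed.

(** Taken by coordinates, so that the mean value theorem and the integral of real functions apply
    directly to the real and imaginary parts. *)
Definition is_path_derive (g : R -> C) (t : R) (l : C) : Prop :=
  is_derive (fun s => Re (g s)) t (Re l) /\ is_derive (fun s => Im (g s)) t (Im l).

Lemma is_path_derive_iff (g : R -> C) (t : R) (l : C) :
  is_path_derive g t l <->
  forall eps : R, 0 < eps -> exists d : R, 0 < d /\ forall s, Rabs (s - t) < d ->
    Cmod (g s - g t - l * (s - t)%R) <= eps * Rabs (s - t).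
Proof.
assert (Er : forall s, Re (g s - g t - l * (s - t)%R)%C
   = Re (g s) - Re (g t) - Re l * (s - t)) by (intros; unfold Re; simpl; ring).
assert (Ei : forall s, Im (g s - g t - l * (s - t)%R)%C
   = Im (g s) - Im (g t) - Im l * (s - t)) by (intros; unfold Im; simpl; ring).
split.
- intros [H1 H2] eps Heps.
  destruct (proj1 (is_derive_R_iff _ _ _) H1 (eps / 2) ltac:(lra)) as [d1 [P1 D1]].
  destruct (proj1 (is_derive_R_iff _ _ _) H2 (eps / 2) ltac:(lra)) as [d2 [P2 D2]].
  exists (Rmin d1 d2). split; [now apply Rmin_pos|]. intros s Hs.
  eapply Rle_trans; [apply Cmod_le_sum|]. rewrite Er, Ei.
  assert (A := D1 s (Rlt_le_trans _ _ _ Hs (Rmin_l _ _))).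
  assert (B := D2 s (Rlt_le_trans _ _ _ Hs (Rmin_r _ _))). lra.
- intros H. split; apply is_derive_R_iff; intros eps Heps;
  destruct (H eps Heps) as [d [Hd D]]; exists d; (split; [exact Hd|]);
  intros s Hs; eapply Rle_trans; try exact (D s Hs).
  + rewrite <- Er. apply re_le_Cmod.
  + rewrite <- Ei. apply im_le_Cmod.
Qed.

Lemma is_path_derive_comp (f : C -> C) (g : R -> C) (t : R) (df dg : C) :
  is_Cderive f (g t) df -> is_path_derive g t dg ->
  is_path_derive (fun s => f (g s)) t (df * dg)%C.
Proof.
intros Hf Hg. apply is_path_derive_iff. intros eps Heps.
assert (Pf := Cmod_ge_0 df). assert (Pg := Cmod_ge_0 dg).
(* Each of the two error terms gets [eps / 2]: [e1] is multiplied by the Lipschitz bound [|dg| + 1]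
   of [g] near [t], which holds because [e2 <= 1], and [e2] is multiplied by [|df|]. *)
set (e1 := eps / (2 * (Cmod dg + 1))). set (e2 := Rmin 1 (eps / (2 * (Cmod df + 1)))).
assert (He1 : 0 < e1) by (apply Rdiv_lt_0_compat; lra).
assert (He2 : 0 < e2) by (apply Rmin_pos; [lra | apply Rdiv_lt_0_compat; lra]).
assert (He2' : e2 <= 1) by apply Rmin_l.
assert (Ee1 : e1 * (Cmod dg + 1) = eps / 2) by (unfold e1; field; lra).
assert (Ee2 : e2 * (Cmod df + 1) <= eps / 2).
{ apply Rle_trans with (eps / (2 * (Cmod df + 1)) * (Cmod df + 1)).
  - apply Rmult_le_compat_r; [lra | apply Rmin_r].
  - right; field; lra. }
destruct (proj1 (is_Cderive_iff _ _ _) Hf e1 He1) as [d1 [P1 D1]].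
destruct (proj1 (is_path_derive_iff _ _ _) Hg e2 He2) as [d2 [P2 D2]].
exists (Rmin d2 (d1 / (Cmod dg + 1))). split.
{ apply Rmin_pos; auto. apply Rdiv_lt_0_compat; lra. }
intros s Hs.
assert (B := D2 s (Rlt_le_trans _ _ _ Hs (Rmin_l _ _))).
assert (Hs2 := Rlt_le_trans _ _ _ Hs (Rmin_r _ _)).
assert (Pa := Rabs_pos (s - t)).
assert (Hgs : Cmod (g s - g t) <= (Cmod dg + 1) * Rabs (s - t)).
{ replace (g s - g t)%C with ((g s - g t - dg * (s - t)%R) + dg * (s - t)%R)%C by ring.
  eapply Rle_trans; [apply Cmod_triangle|]. rewrite Cmod_mult, Cmod_R. nra. }
assert (A : Cmod (g s - g t) < d1).
{ eapply Rle_lt_trans; [exact Hgs|].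
  apply Rmult_lt_reg_l with (/ (Cmod dg + 1)); [apply Rinv_0_lt_compat; lra|].
  rewrite <- Rmult_assoc, Rinv_l, Rmult_1_l by lra. rewrite Rmult_comm. exact Hs2. }
assert (A' := D1 _ A).
replace (f (g s) - f (g t) - df * dg * (s - t)%R)%C
  with ((f (g s) - f (g t) - df * (g s - g t)) + df * (g s - g t - dg * (s - t)%R))%C
  by ring.
eapply Rle_trans; [apply Cmod_triangle|]. rewrite Cmod_mult.
assert (e1 * Cmod (g s - g t) <= eps / 2 * Rabs (s - t)).
{ rewrite <- Ee1, Rmult_assoc. apply Rmult_le_compat_l; lra. }
assert (Cmod df * Cmod (g s - g t - dg * (s - t)%R)%C <= eps / 2 * Rabs (s - t)).
{ apply Rle_trans with ((Cmod df + 1) * (e2 * Rabs (s - t))).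
  - apply Rmult_le_compat; try lra; apply Cmod_ge_0.
  - rewrite <- Rmult_assoc. apply Rmult_le_compat_r; lra. }
lra.
Qed.

Lemma is_path_derive_segment (z w : C) (t : R) :
  is_path_derive (fun s => z + RtoC s * (w - z))%C t (w - z)%C.
Proof.
apply is_path_derive_iff. intros eps Heps. exists 1. split; [lra|]. intros s _.
replace (z + s * (w - z) - (z + t * (w - z)) - (w - z) * (s - t)%R)%C with (RtoC 0)
  by (rewrite RtoC_minus; ring).
rewrite Cmod_0. assert (H := Rabs_pos (s - t)). nra.
Qed.

Lemma is_path_derive_continuous (g : R -> C) (t : R) (l : C) :
  is_path_derive g t l -> @continuous R_UniformSpace Cspace g t.
Proof.
intros [H1 H2]. apply continuous_C_pair;
  apply (ex_derive_continuous (V := R_NormedModule)); eexists; eassumption.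
Qed.

(** The real theorem is applied separately to the real and imaginary parts, hence the factor 2.
    Derivatives are required on the open segment and continuity on the closed one. *)
Lemma mean_value_C (f df : C -> C) (z w : C) (M : R) :
  (forall s : R, 0 < s < 1 ->
     is_Cderive f (z + s * (w - z))%C (df (z + s * (w - z))%C) /\
     Cmod (df (z + s * (w - z))%C) <= M) ->
  (forall s : R, 0 <= s <= 1 -> @continuous Cspace Cspace f (z + s * (w - z))%C) ->
  Cmod (f w - f z) <= 2 * M * Cmod (w - z).
Proof.
intros Hd Hc.
set (g := fun s : R => (z + s * (w - z))%C) in *.
assert (D : forall s, 0 < s < 1 ->
   is_path_derive (fun s => f (g s)) s (df (g s) * (w - z))%C).
{ intros s Hs. apply is_path_derive_comp; [now apply Hd|].
  apply is_path_derive_segment. }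
assert (Cg : forall s, 0 <= s <= 1 ->
  @continuous R_UniformSpace Cspace (fun s => f (g s)) s).
{ intros s Hs. apply (@continuous_comp R_UniformSpace Cspace Cspace g f); [|now apply Hc].
  eapply is_path_derive_continuous. apply is_path_derive_segment. }
assert (E0 : g 0 = z) by (unfold g; ring). assert (E1 : g 1 = w) by (unfold g; ring).
assert (HM : 0 <= M)
  by (apply Rle_trans with (2 := proj2 (Hd (1 / 2) ltac:(lra))); apply Cmod_ge_0).
assert (B : forall p : C -> R, (forall u, Rabs (p u) <= Cmod u) ->
  (forall u v, p (u - v)%C = p u - p v) ->
  (forall u, @continuous Cspace R_UniformSpace p u) ->
  (forall s, 0 < s < 1 -> is_derive (fun s => p (f (g s))) s (p (df (g s) * (w - z))%C)) ->
  Rabs (p (f w - f z)%C) <= M * Cmod (w - z)).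
{ intros p Hp Hs Hpc Hpd.
  (* The intermediate point [c] is only known to lie in the closed interval, whereas [df] is bounded
     on the open one; giving the derivative the value 0 elsewhere keeps the bound at the
     endpoints. *)
  set (inside := fun s => if Rlt_dec 0 s then if Rlt_dec s 1 then true else false else false).
  destruct (MVT_gen (fun s => p (f (g s))) 0 1
    (fun s => if inside s then p (df (g s) * (w - z))%C else 0)) as [c [_ Hc1]].
  - intros s Hs'. rewrite Rmin_left, Rmax_right in Hs' by lra.
    unfold inside. destruct (Rlt_dec 0 s); [|lra]. destruct (Rlt_dec s 1); [|lra].
    now apply Hpd.
  - intros s Hs'. rewrite Rmin_left, Rmax_right in Hs' by lra.
    apply continuity_pt_filterlim. apply (@continuous_comp R_UniformSpace Cspace R_UniformSpace (fun s => f (g s)) p);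
    auto.
  - rewrite E0, E1 in Hc1. rewrite Hs, Hc1, Rminus_0_r, Rmult_1_r.
    assert (P : 0 <= M * Cmod (w - z)) by (apply Rmult_le_pos; auto; apply Cmod_ge_0).
    unfold inside. destruct (Rlt_dec 0 c); [|now rewrite Rabs_R0].
    destruct (Rlt_dec c 1); [|now rewrite Rabs_R0].
    eapply Rle_trans; [apply Hp|]. rewrite Cmod_mult.
    apply Rmult_le_compat_r; [apply Cmod_ge_0|]. apply Hd. lra. }
eapply Rle_trans; [apply Cmod_le_sum|].
assert (B1 : Rabs (Re (f w - f z)) <= M * Cmod (w - z)).
{ apply B; [exact re_le_Cmod | intros; unfold Re; simpl; ring | exact continuous_Re |].
  intros s Hs. now apply D. }
assert (B2 : Rabs (Im (f w - f z)) <= M * Cmod (w - z)).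
{ apply B; [exact im_le_Cmod | intros; unfold Im; simpl; ring | exact continuous_Im |].
  intros s Hs. now apply D. }
lra.
Qed.

Lemma segment_in_disc (a z w : C) (r s : R) :
  Cmod (z - a) < r -> Cmod (w - a) < r -> 0 <= s <= 1 ->
  Cmod (z + s * (w - z) - a) < r.
Proof.
intros Hz Hw Hs.
replace (z + s * (w - z) - a)%C with ((1 - s)%R * (z - a) + s * (w - a))%C
  by (rewrite RtoC_minus; ring).
eapply Rle_lt_trans; [apply Cmod_triangle|].
rewrite !Cmod_mult, !Cmod_R, !Rabs_pos_eq by lra.
destruct (Req_dec s 0) as [->|Hs0]; nra.
Qed.

Lemma mean_value_disc (f df : C -> C) (a : C) (r M : R) :
  (forall z, Cmod (z - a) < r -> is_Cderive f z (df z) /\ Cmod (df z) <= M) ->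
  forall z w, Cmod (z - a) < r -> Cmod (w - a) < r ->
  Cmod (f w - f z) <= 2 * M * Cmod (w - z).
Proof.
intros H z w Hz Hw. apply (mean_value_C f df).
- intros s Hs. apply H. apply segment_in_disc; auto; lra.
- intros s Hs. eapply is_Cderive_continuous. apply H. now apply segment_in_disc.
Qed.

Lemma C_derive_zero (f : C -> C) (x : C) :
  @locally Cspace x (fun y => is_Cderive f y 0%C) ->
  @locally Cspace x (fun y => f y = f x).
Proof.
intros H. apply locally_Cmod in H. destruct H as [d [Hd H]].
apply locally_Cmod. exists d. split; auto. intros y Hy.
apply Ceq_minus. apply Cmod_eq_0. apply Rle_antisym; [|apply Cmod_ge_0].
replace 0 with (2 * 0 * Cmod (y - x)) by ring.
apply (mean_value_disc f (fun _ => 0%C) x d); auto.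
- intros z Hz. split; [now apply H | rewrite Cmod_0; lra].
- replace (x - x)%C with (RtoC 0) by ring. now rewrite Cmod_0.
Qed.

(** * Local inverses *)

Lemma C_series_converges (a : nat -> C) (M : R) :
  (forall n, Cmod (a n) <= M * (/ 2) ^ n) ->
  exists l : C, forall eps, 0 < eps -> exists N, forall n, (N <= n)%nat ->
    Cmod (sum_n a n - l) < eps.
Proof.
intros H.
assert (Hs : ex_series (fun n => M * (/ 2) ^ n)).
{ apply (ex_series_scal_l (V := R_NormedModule) M). apply ex_series_geom.
  rewrite Rabs_pos_eq; lra. }
destruct (@ex_series_le C_AbsRing C_CompleteNormedModule a (fun n => M * (/ 2) ^ n))
  as [l Hl]; auto.
exists l. intros eps Heps.
assert (Hb : @locally C_UniformSpace l (fun w => Cmod (w - l) < eps)).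
{ apply locally_C. apply locally_Cmod. exists eps. auto. }
exact (Hl _ Hb).
Qed.

(** The steps of the iteration are at most [r / 4], [r / 8], and so on, so all iterates stay within
    [r / 2] of [t0]: [T] is never applied outside the disc where it contracts, and the limit lies
    strictly inside. *)
Lemma contraction_fixed_point (T : C -> C) (t0 : C) (r : R) :
  0 < r -> Cmod (T t0 - t0) <= r / 4 ->
  (forall s t, Cmod (s - t0) < r -> Cmod (t - t0) < r ->
     Cmod (T t - T s) <= / 2 * Cmod (t - s)) ->
  exists t, Cmod (t - t0) < r /\ T t = t.
Proof.
intros Hr H0 HT.
set (x := fix x n := match n with O => t0 | S n => T (x n) end).
assert (Hx : forall n, Cmod (x n - t0) <= r / 2 * (1 - (/ 2) ^ n) /\
   Cmod (x (S n) - x n) <= r / 4 * (/ 2) ^ n).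
{ induction n as [|n [IH1 IH2]].
  - change (x 1%nat) with (T t0). change (x O) with t0.
    replace (t0 - t0)%C with (RtoC 0) by ring. rewrite Cmod_0, pow_O. split; lra.
  - assert (P : 0 < (/ 2) ^ n) by (apply pow_lt; lra).
    assert (A : Cmod (x (S n) - t0) <= r / 2 * (1 - (/ 2) ^ S n)).
    { replace (x (S n) - t0)%C with ((x (S n) - x n) + (x n - t0))%C by ring.
      eapply Rle_trans; [apply Cmod_triangle|].
      change ((/ 2) ^ S n) with (/ 2 * (/ 2) ^ n). nra. }
    split; auto.
    change (Cmod (T (x (S n)) - T (x n)) <= r / 4 * (/ 2) ^ S n).
    eapply Rle_trans; [apply HT|].
    + nra.
    + change ((/ 2) ^ S n) with (/ 2 * (/ 2) ^ n) in A. nra.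
    + change ((/ 2) ^ S n) with (/ 2 * (/ 2) ^ n). nra. }
destruct (C_series_converges (fun n => x (S n) - x n)%C (r / 4)) as [l Hl];
  [intros n; apply Hx|].
assert (Hsum : forall n, sum_n (fun n => x (S n) - x n)%C n = (x (S n) - t0)%C).
{ induction n as [|n IH].
  - now rewrite sum_O.
  - rewrite sum_Sn, IH. 
    change (((x (S n) - t0) + (x (S (S n)) - x (S n)))%C = (x (S (S n)) - t0)%C).
    ring. }
assert (Hlim : forall eps, 0 < eps -> exists n,
   Cmod (x n - (t0 + l)) < eps /\ Cmod (x (S n) - (t0 + l)) < eps).
{ intros eps Heps. destruct (Hl eps Heps) as [N HN]. exists (S N).
  assert (A := HN N ltac:(lia)). assert (B := HN (S N) ltac:(lia)).
  rewrite Hsum in A, B.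
  replace (x (S N) - (t0 + l))%C with (x (S N) - t0 - l)%C by ring.
  replace (x (S (S N)) - (t0 + l))%C with (x (S (S N)) - t0 - l)%C by ring. auto. }
assert (Hin : forall n, Cmod (x n - t0) <= r / 2).
{ intros n. destruct (Hx n) as [A _]. assert (0 < (/ 2) ^ n) by (apply pow_lt; lra). nra. }
assert (Hl' : Cmod (t0 + l - t0) < r).
{ destruct (Hlim (r / 4) ltac:(lra)) as [n [Hn _]].
  replace (t0 + l - t0)%C with ((x n - t0) - (x n - (t0 + l)))%C by ring.
  unfold Cminus at 1. eapply Rle_lt_trans; [apply Cmod_triangle|]. rewrite Cmod_opp.
  generalize (Hin n). lra. }
exists (t0 + l)%C. split; auto.
apply Ceq_minus, Cmod_eq_0. apply Rle_antisym; [|apply Cmod_ge_0].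
apply le_epsilon. intros eps Heps.
destruct (Hlim (eps / 2) ltac:(lra)) as [n [Hn Hn']].
replace (T (t0 + l) - (t0 + l))%C
  with ((T (t0 + l) - T (x n)) + (x (S n) - (t0 + l)))%C by (simpl; ring).
eapply Rle_trans; [apply Cmod_triangle|].
assert (A := HT (x n) (t0 + l)%C ltac:(generalize (Hin n); lra) Hl').
rewrite Cmod_minus_sym in Hn. lra.
Qed.

(** Solving [u t = y] amounts to finding a fixed point of [t + (y - u t) / a], where [a] is the
    derivative at [t0]. Keeping [du] within [|a| / 4] of [a] makes [u t - a t] Lipschitz with
    constant [|a| / 2], because of the factor 2 in the mean value inequality, so this map contracts
    by one half. *)
Lemma local_inverse (u du : C -> C) (t0 : C) (r : R) :
  0 < r ->
  (forall t, Cmod (t - t0) < r -> is_Cderive u t (du t)) ->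
  @continuous Cspace Cspace du t0 -> du t0 <> 0%C ->
  exists (tau : C -> C) (d : R), 0 < d /\ forall y, Cmod (y - u t0) < d ->
    Cmod (tau y - t0) < r /\ u (tau y) = y /\ is_Cderive tau y (/ du (tau y))%C.
Proof.
intros Hr Hu Hc Ha. set (a := du t0) in *. set (m := Cmod a).
assert (Hm : 0 < m) by now apply Cmod_gt_0.
assert (Hloc : @locally Cspace t0 (fun t => Cmod (du t - a) < m / 4)).
{ apply (Hc (fun w => Cmod (w - a) < m / 4)). apply locally_Cmod.
  exists (m / 4). split; auto. lra. }
apply locally_Cmod in Hloc. destruct Hloc as [r1 [Hr1 Hdu]].
set (p := Rmin r r1).
assert (Hp : 0 < p) by now apply Rmin_pos.
assert (Hpr : p <= r) by apply Rmin_l. assert (Hpr1 : p <= r1) by apply Rmin_r.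
assert (Hh : forall s t, Cmod (s - t0) < p -> Cmod (t - t0) < p ->
   Cmod ((u t - a * t) - (u s - a * s)) <= m / 2 * Cmod (t - s)).
{ intros s t Hs Ht. replace (m / 2) with (2 * (m / 4)) by lra.
  apply (mean_value_disc (fun t => u t - a * t)%C (fun t => du t - a)%C t0 p); auto.
  intros z Hz. split; [|left; apply Hdu; lra].
  apply is_Cderive_minus; [apply Hu; lra|].
  replace a with (0 * z + a * 1)%C at 2 by ring.
  apply (is_Cderive_mult (fun _ => a) (fun w => w)).
  - apply is_Cderive_const.
  - apply is_Cderive_id. }
(* [m * p / 4] is the size of [y - u t0] for which the first iterate moves by at most [p / 4]. For
   other [y] the statement is void and [t0] serves as default, so that a total function can be
   chosen. *)
assert (Hex : forall y, exists t, Cmod (y - u t0) < m * p / 4 ->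
   Cmod (t - t0) < p /\ u t = y).
{ intros y. destruct (Rlt_dec (Cmod (y - u t0)) (m * p / 4)) as [Hy|Hy];
    [|exists t0; tauto].
  destruct (contraction_fixed_point (fun t => t + (y - u t) / a)%C t0 p) as [t [Ht1 Ht2]];
    auto.
  - replace (t0 + (y - u t0) / a - t0)%C with ((y - u t0) / a)%C by ring.
    rewrite Cmod_div by auto. fold m. apply Rmult_le_reg_r with m; auto.
    unfold Rdiv at 1. rewrite Rmult_assoc, Rinv_l by lra. lra.
  - intros s t Hs Ht.
    replace (t + (y - u t) / a - (s + (y - u s) / a))%C
      with (- (((u t - a * t) - (u s - a * s)) / a))%C by (field; auto).
    rewrite Cmod_opp, Cmod_div by auto. fold m.
    apply Rmult_le_reg_r with m; auto. unfold Rdiv.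
    rewrite Rmult_assoc, Rinv_l by lra. generalize (Hh s t Hs Ht). lra.
  - exists t. intros _. split; auto.
    transitivity (y - a * ((t + (y - u t) / a) - t))%C; [field; auto | rewrite Ht2; ring]. }
set (tau := fun y => proj1_sig (constructive_indefinite_description _ (Hex y))).
assert (Htau : forall y, Cmod (y - u t0) < m * p / 4 ->
   Cmod (tau y - t0) < p /\ u (tau y) = y).
{ intros y. exact (proj2_sig (constructive_indefinite_description _ (Hex y))). }
assert (Hmp : 0 < m * p / 4) by nra.
exists tau, (m * p / 4). split; auto.
intros y Hy. destruct (Htau y Hy) as [T1 T2].
split; [lra|]. split; auto.
(* [tau] comes from a choice, so its continuity must be proved: since [u] is [a t] up to a
   perturbation of half its size, [tau] is Lipschitz with constant [2 / m]. *)
assert (HL : forall y', Cmod (y' - u t0) < m * p / 4 ->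
   m / 2 * Cmod (tau y' - tau y) <= Cmod (y' - y)).
{ intros y' Hy'. destruct (Htau y' Hy') as [T1' T2'].
  assert (A := Hh (tau y) (tau y') T1 T1'). rewrite T2, T2' in A.
  generalize (Cmod_triangle_minus (a * (tau y' - tau y)) (y' - y)).
  replace (a * (tau y' - tau y) - (y' - y))%C
    with (- (y' - a * tau y' - (y - a * tau y)))%C by ring.
  rewrite Cmod_opp, Cmod_mult. fold m. lra. }
set (d := du (tau y)).
assert (Hd : d <> 0%C).
{ apply Cmod_gt_0. generalize (Cmod_triangle_minus a d) (Hdu (tau y) ltac:(lra)).
  rewrite Cmod_minus_sym. fold d m. lra. }
assert (Hmd : 0 < Cmod d) by now apply Cmod_gt_0.
apply is_Cderive_iff. intros eps Heps.
(* The error of [u] is measured in [tau y' - tau y]; the Lipschitz constant [2 / m] and the division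
   by [d] turn this threshold into [eps]. Likewise [m * r2 / 2] below keeps [tau y'] within [r2] of
   [tau y]. *)
assert (He1 : 0 < eps * m * Cmod d / 2) by (repeat apply Rmult_lt_0_compat; lra).
destruct (proj1 (is_Cderive_iff _ _ _) (Hu (tau y) ltac:(lra)) _ He1) as [r2 [Hr2 Hd2]].
exists (Rmin (m * p / 4 - Cmod (y - u t0)) (m * r2 / 2)). split.
{ apply Rmin_pos; nra. }
intros y' Hy'.
assert (H1 := Rlt_le_trans _ _ _ Hy' (Rmin_l _ _)).
assert (H2 := Rlt_le_trans _ _ _ Hy' (Rmin_r _ _)).
assert (Hy2 : Cmod (y' - u t0) < m * p / 4).
{ replace (y' - u t0)%C with ((y' - y) + (y - u t0))%C by ring.
  eapply Rle_lt_trans; [apply Cmod_triangle|]. lra. }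
destruct (Htau y' Hy2) as [T1' T2']. assert (L := HL y' Hy2).
assert (B := Hd2 (tau y') ltac:(nra)). rewrite T2, T2' in B. fold d in B.
replace (tau y' - tau y - / d * (y' - y))%C
  with (- ((y' - y - d * (tau y' - tau y)) / d))%C by (field; auto).
rewrite Cmod_opp, Cmod_div by auto.
apply Rmult_le_reg_r with (Cmod d); auto. unfold Rdiv at 1.
rewrite Rmult_assoc, Rinv_l, Rmult_1_r by lra.
eapply Rle_trans; [exact B|].
assert (0 <= eps * Cmod d) by nra.
nra.
Qed.

(** * Cauchy's formula *)

Notation Ccontinuous g t := (@continuous _ Cspace g t).

Section Continuity.

Context {T : UniformSpace}.
Implicit Types (g h : T -> C) (t : T).

Lemma Ccontinuous_const (a : C) t : Ccontinuous (fun _ : T => a) t.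
Proof. apply (@continuous_const T Cspace). Qed.

Lemma Ccontinuous_plus g h t :
  Ccontinuous g t -> Ccontinuous h t -> Ccontinuous (fun s => g s + h s)%C t.
Proof. exact (@continuous_plus T C_AbsRing (AbsRing_NormedModule C_AbsRing) g h t). Qed.

Lemma Ccontinuous_minus g h t :
  Ccontinuous g t -> Ccontinuous h t -> Ccontinuous (fun s => g s - h s)%C t.
Proof. exact (@continuous_minus T C_AbsRing (AbsRing_NormedModule C_AbsRing) g h t). Qed.

Lemma Ccontinuous_mult g h t :
  Ccontinuous g t -> Ccontinuous h t -> Ccontinuous (fun s => g s * h s)%C t.
Proof. exact (@continuous_mult T C_AbsRing g h t). Qed.

Lemma Ccontinuous_comp (f : C -> C) g t :
  @continuous Cspace Cspace f (g t) -> Ccontinuous g t ->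
  Ccontinuous (fun s => f (g s)) t.
Proof. intros Hf Hg. exact (@continuous_comp T Cspace Cspace g f t Hg Hf). Qed.

Lemma Ccontinuous_inv g t :
  Ccontinuous g t -> g t <> 0%C -> Ccontinuous (fun s => / g s)%C t.
Proof.
intros Hg H0. apply (Ccontinuous_comp Cinv); auto.
eapply is_Cderive_continuous. now apply is_Cderive_inv_id.
Qed.

Lemma Ccontinuous_pow g t (n : nat) :
  Ccontinuous g t -> Ccontinuous (fun s => g s ^ n)%C t.
Proof.
intros Hg. induction n as [|n IH].
- apply Ccontinuous_const.
- now apply Ccontinuous_mult.
Qed.

End Continuity.

(** * Integrals over a circle *)

Definition circle (r t : R) : C := (r * cos t, r * sin t).

Lemma circle_derive (r t : R) : is_path_derive (circle r) t (Ci * circle r t)%C.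
Proof. split; unfold Re, Im, circle; simpl; auto_derive; auto; ring. Qed.

Lemma circle_continuous (r t : R) : @continuous R_UniformSpace Cspace (circle r) t.
Proof. eapply is_path_derive_continuous. apply circle_derive. Qed.

Lemma Cmod_circle (r t : R) : 0 <= r -> Cmod (circle r t) = r.
Proof.
intros Hr. unfold Cmod, circle. simpl.
replace (r * cos t * (r * cos t * 1) + r * sin t * (r * sin t * 1)) with (r * r).
- now apply sqrt_square.
- generalize (sin2_cos2 t). unfold Rsqr. intros H.
  transitivity (r * r * (sin t * sin t + cos t * cos t)); [rewrite H|]; ring.
Qed.

Lemma circle_period (r : R) : circle r (2 * PI) = circle r 0.
Proof. unfold circle. now rewrite cos_2PI, sin_2PI, cos_0, sin_0. Qed.

(** The integral is taken in the angle [dt]; a contour integral in [dz] thus shows up with an extra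
    factor [circle r t] in the integrand, the constant [Ci] being divided out. *)
Definition Ccircle_int (g : R -> C) : C :=
  (RInt (fun t => Re (g t)) 0 (2 * PI), RInt (fun t => Im (g t)) 0 (2 * PI)).

Lemma ex_RInt_Re (g : R -> C) (a b : R) :
  (forall t, @continuous R_UniformSpace Cspace g t) ->
  ex_RInt (fun t => Re (g t)) a b.
Proof.
intros H. apply (ex_RInt_continuous (V := R_CompleteNormedModule)). intros t _.
exact (@continuous_comp R_UniformSpace Cspace R_UniformSpace g Re t (H t)
  (continuous_Re _)).
Qed.

Lemma ex_RInt_Im (g : R -> C) (a b : R) :
  (forall t, @continuous R_UniformSpace Cspace g t) ->
  ex_RInt (fun t => Im (g t)) a b.
Proof.
intros H. apply (ex_RInt_continuous (V := R_CompleteNormedModule)). intros t _.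
exact (@continuous_comp R_UniformSpace Cspace R_UniformSpace g Im t (H t)
  (continuous_Im _)).
Qed.

Lemma Ccircle_int_ext (g h : R -> C) :
  (forall t, g t = h t) -> Ccircle_int g = Ccircle_int h.
Proof.
intros H. unfold Ccircle_int. f_equal; apply RInt_ext; intros t _; now rewrite H.
Qed.

Lemma Ccircle_int_plus (g h : R -> C) :
  (forall t, @continuous R_UniformSpace Cspace g t) ->
  (forall t, @continuous R_UniformSpace Cspace h t) ->
  Ccircle_int (fun t => g t + h t)%C = (Ccircle_int g + Ccircle_int h)%C.
Proof.
intros Hg Hh. unfold Ccircle_int, Cplus. simpl. f_equal.
- rewrite <- (RInt_plus (V := R_CompleteNormedModule)) by now apply ex_RInt_Re.
  apply RInt_ext. reflexivity.
- rewrite <- (RInt_plus (V := R_CompleteNormedModule)) by now apply ex_RInt_Im.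
  apply RInt_ext. reflexivity.
Qed.

Lemma Ccircle_int_scal (c : C) (g : R -> C) :
  (forall t, @continuous R_UniformSpace Cspace g t) ->
  Ccircle_int (fun t => c * g t)%C = (c * Ccircle_int g)%C.
Proof.
intros Hg.
assert (I1 := ex_RInt_Re g 0 (2 * PI) Hg). assert (I2 := ex_RInt_Im g 0 (2 * PI) Hg).
apply (RInt_correct (V := R_CompleteNormedModule)) in I1.
apply (RInt_correct (V := R_CompleteNormedModule)) in I2.
unfold Ccircle_int, Cmult. simpl. f_equal; apply is_RInt_unique.
- exact (is_RInt_minus (V := R_NormedModule) _ _ _ _ _ _
    (is_RInt_scal _ _ _ (fst c) _ I1) (is_RInt_scal _ _ _ (snd c) _ I2)).
- exact (is_RInt_plus (V := R_NormedModule) _ _ _ _ _ _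
    (is_RInt_scal _ _ _ (fst c) _ I2) (is_RInt_scal _ _ _ (snd c) _ I1)).
Qed.

(** Each of the two coordinates contributes [2 * PI * M]. *)
Lemma Ccircle_int_bound (g : R -> C) (M : R) :
  (forall t, @continuous R_UniformSpace Cspace g t) ->
  (forall t, 0 <= t <= 2 * PI -> Cmod (g t) <= M) ->
  Cmod (Ccircle_int g) <= 4 * PI * M.
Proof.
intros Hg HM. assert (HPI := PI_RGT_0).
assert (B : forall h : R -> R, ex_RInt h 0 (2 * PI) -> 
  (forall t, 0 <= t <= 2 * PI -> Rabs (h t) <= M) ->
  Rabs (RInt h 0 (2 * PI)) <= 2 * PI * M).
{ intros h Hh Hb.
  apply (norm_RInt_le (V := R_NormedModule) h (fun _ => M) 0 (2 * PI)).
  - lra.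
  - exact Hb.
  - now apply (RInt_correct (V := R_CompleteNormedModule)).
  - replace (2 * PI * M) with (scal (2 * PI - 0) M)
      by (unfold scal; simpl; unfold mult; simpl; ring).
    apply (is_RInt_const (V := R_NormedModule)). }
eapply Rle_trans; [apply Cmod_le_sum|].
assert (B1 := B _ (ex_RInt_Re g 0 (2 * PI) Hg)
  (fun t Ht => Rle_trans _ _ _ (re_le_Cmod (g t)) (HM t Ht))).
assert (B2 := B _ (ex_RInt_Im g 0 (2 * PI) Hg)
  (fun t Ht => Rle_trans _ _ _ (im_le_Cmod (g t)) (HM t Ht))).
unfold Ccircle_int, Re, Im in *. simpl in *. lra.
Qed.

(** For [x = 1 / (e - z)], [y = 1 / (e - w)] and [h = w - z] the relation [y - x = h x y] holds, and
    the bound is the second order Taylor estimate for a power of the Cauchy kernel. [M] depends on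
    [k] and [n] alone, hence is uniform on the circle, which permits differentiation under the
    integral. *)
Lemma pow_remainder (n : nat) (k : R) : 0 <= k -> exists M, 0 <= M /\
  forall x y h : C, Cmod x <= k -> Cmod y <= k -> (y - x = h * x * y)%C ->
    Cmod (y ^ n - x ^ n - h * (INR n * x ^ S n)) <= M * Cmod h ^ 2.
Proof.
intros Hk. induction n as [|n [M [HM IH]]].
- exists 0. split; [lra|]. intros x y h _ _ _. simpl.
  replace (1 - 1 - h * (0 * (x * 1)))%C with (RtoC 0) by ring. rewrite Cmod_0. lra.
- exists (k * M + INR (S n) * k ^ (n + 3)).
  assert (P : 0 <= INR (S n) * k ^ (n + 3))
    by (apply Rmult_le_pos; [apply pos_INR | now apply pow_le]).
  split; [nra|]. intros x y h Hx Hy E.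
  replace (y ^ S n - x ^ S n - h * (INR (S n) * x ^ S (S n)))%C
    with (y * (y ^ n - x ^ n - h * (INR n * x ^ S n))
      + INR (S n) * (h ^ 2 * (x ^ (n + 2) * y)))%C.
  + eapply Rle_trans; [apply Cmod_triangle|].
    rewrite !Cmod_mult, !Cmod_pow, Cmod_R, (Rabs_pos_eq (INR (S n))) by apply pos_INR.
    rewrite Rmult_plus_distr_r. apply Rplus_le_compat.
    * rewrite Rmult_assoc. apply Rmult_le_compat; auto; apply Cmod_ge_0.
    * rewrite Rmult_assoc. apply Rmult_le_compat_l; [apply pos_INR|].
      rewrite Rmult_comm. apply Rmult_le_compat_r; [apply pow_le, Cmod_ge_0|].
      replace (n + 3)%nat with (S (n + 2)) by lia. rewrite <- tech_pow_Rmult.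
      rewrite (Rmult_comm k). apply Rmult_le_compat; auto.
      -- apply pow_le, Cmod_ge_0.
      -- apply Cmod_ge_0.
      -- apply pow_incr. split; auto. apply Cmod_ge_0.
  + rewrite S_INR, RtoC_plus, Cpow_add_r. simpl.
    assert (Ey : y = (x + h * x * y)%C) by (rewrite <- E; ring).
    set (X := (x ^ n)%C). set (Y := (y ^ n)%C). set (N := RtoC (INR n)).
    apply Ceq_minus.
    transitivity ((x + h * x * y - y) * (X + h * ((N + 1) * (x * X))))%C;
      [ring | rewrite <- Ey; ring].
Qed.

(** * Cauchy's formula by a homotopy, and smoothness *)

Section Cauchy.

Context (f f1 : C -> C) (z0 : C) (r : R).
Context (r_pos : 0 < r).
Context (f_C1 : forall z, Cmod (z - z0) < 2 * r ->
  is_Cderive f z (f1 z) /\ @continuous Cspace Cspace f1 z).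

(* The circle traced by [z0 + b + s (e - s b)], [|e| = r], shrinks from
   [|z - z0| = r] at [s = 1] to the point [z0 + b] at [s = 0]; the Cauchy kernel
   becomes [e / (e - s b)]. *)
Definition homotopy (b s e : C) : C := (z0 + b + s * (e - s * b))%C.

Definition cauchy_integrand (b s e : C) : C :=
  (f (homotopy b s e) * (e * / (e - s * b)))%C.

Definition cauchy_integrand_ds (b s e : C) : C :=
  (f1 (homotopy b s e) * (e - 2 * s * b) * (e * / (e - s * b))
   + f (homotopy b s e) * (e * b * (/ (e - s * b) * / (e - s * b))))%C.

Definition admissible (b s e : C) : Prop :=
  Cmod (homotopy b s e - z0) < 2 * r /\ (e - s * b <> 0)%C.

Lemma cauchy_integrand_derive (b s e : C) :
  admissible b s e ->
  is_Cderive (fun s => cauchy_integrand b s e) s (cauchy_integrand_ds b s e).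
Proof.
intros [Hin Hne]. unfold cauchy_integrand, cauchy_integrand_ds, homotopy in *.
assert (D1 : is_Cderive (fun s => e - s * b)%C s (0 - (1 * b + s * 0))%C).
{ apply is_Cderive_minus; [apply is_Cderive_const|].
  apply (is_Cderive_mult (fun s => s) (fun _ => b));
    [apply is_Cderive_id | apply is_Cderive_const]. }
assert (D2 := is_Cderive_mult (fun s => s) (fun s => e - s * b)%C _ _ _
  (is_Cderive_id s) D1).
assert (D3 := is_Cderive_plus _ (fun s => s * (e - s * b))%C _ _ _
  (is_Cderive_const (z0 + b)%C s) D2).
assert (D4 := is_Cderive_comp f (fun s => z0 + b + s * (e - s * b))%C s _ _ (proj1 (f_C1 _ Hin)) D3).
assert (D5 := is_Cderive_mult (fun _ => e) (fun s => / (e - s * b))%C _ _ _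
  (is_Cderive_const e s)
  (is_Cderive_inv (fun s => e - s * b)%C s _ Hne D1)).
assert (D6 := is_Cderive_mult (fun s => f (z0 + b + s * (e - s * b)))%C
  (fun s => e * / (e - s * b))%C _ _ _ D4 D5).
match type of D6 with is_Cderive _ _ ?l =>
  match goal with |- is_Cderive _ _ ?l' => replace l' with l; [exact D6|] end end.
cbv beta. field. auto.
Qed.

(** The form [f(z) dz / (z - z0 - b)] is closed, so its variation in [s] along the homotopy is exact
    on the circle: the primitive is [f(z)] times the [s]-derivative of [z], which is [e - 2 s b],
    divided by [Ci (z - z0 - b) = Ci s (e - s b)]. The factor [1 / (Ci e)] converts the derivative
    in the angle into the derivative in [e]. *)
Lemma cauchy_primitive_derive (b s e : C) :
  s <> 0%C -> e <> 0%C -> admissible b s e ->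
  is_Cderive (fun e => / (Ci * s) * (f (homotopy b s e) *
    ((e - 2 * s * b) * / (e - s * b))))%C e
    (/ (Ci * e) * cauchy_integrand_ds b s e)%C.
Proof.
intros Hs He [Hin Hne]. unfold cauchy_integrand_ds, homotopy in *.
assert (D0 : forall c : C, is_Cderive (fun e => e - c)%C e (1 - 0)%C).
{ intros c. apply is_Cderive_minus; [apply is_Cderive_id | apply is_Cderive_const]. }
assert (D1 := is_Cderive_mult (fun _ => s) (fun e => e - s * b)%C _ _ _
  (is_Cderive_const s e) (D0 (s * b)%C)).
assert (D2 := is_Cderive_plus _ (fun e => s * (e - s * b))%C _ _ _
  (is_Cderive_const (z0 + b)%C e) D1).
assert (D3 := is_Cderive_comp f (fun e => z0 + b + s * (e - s * b))%C e _ _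
  (proj1 (f_C1 _ Hin)) D2).
assert (D4 := is_Cderive_mult (fun e => e - 2 * s * b)%C (fun e => / (e - s * b))%C
  _ _ _ (D0 (2 * s * b)%C) (is_Cderive_inv (fun e => e - s * b)%C e _ Hne (D0 (s * b)%C))).
assert (D5 := is_Cderive_mult (fun e => f (z0 + b + s * (e - s * b)))%C
  (fun e => (e - 2 * s * b) * / (e - s * b))%C _ _ _ D3 D4).
assert (D6 := is_Cderive_mult (fun _ => / (Ci * s))%C
  (fun e => f (z0 + b + s * (e - s * b)) * ((e - 2 * s * b) * / (e - s * b)))%C _ _ _
  (is_Cderive_const _ e) D5).
match type of D6 with is_Cderive _ _ ?l =>
  match goal with |- is_Cderive _ _ ?l' => replace l' with l; [exact D6|] end end.
assert (Hi := Ci_nz). cbv beta. field. auto.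
Qed.

Lemma cauchy_integrand_continuous {T : UniformSpace} (b : C) (s e : T -> C) (t : T) :
  Ccontinuous s t -> Ccontinuous e t -> admissible b (s t) (e t) ->
  Ccontinuous (fun t => cauchy_integrand b (s t) (e t)) t /\
  Ccontinuous (fun t => cauchy_integrand_ds b (s t) (e t)) t.
Proof.
intros Hs He [Hin Hne].
assert (K1 : Ccontinuous (fun t => e t - s t * b)%C t).
{ apply Ccontinuous_minus; auto. apply Ccontinuous_mult; auto. apply Ccontinuous_const. }
assert (K2 : Ccontinuous (fun t => homotopy b (s t) (e t)) t).
{ apply Ccontinuous_plus; [apply Ccontinuous_const|]. now apply Ccontinuous_mult. }
assert (K3 : Ccontinuous (fun t => / (e t - s t * b))%C t)
  by now apply Ccontinuous_inv.
assert (K4 : Ccontinuous (fun t => f (homotopy b (s t) (e t))) t).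
{ apply Ccontinuous_comp; auto. eapply is_Cderive_continuous. now apply f_C1. }
assert (K5 : Ccontinuous (fun t => f1 (homotopy b (s t) (e t))) t).
{ apply Ccontinuous_comp; auto. now apply f_C1. }
assert (K6 : Ccontinuous (fun t => e t * / (e t - s t * b))%C t)
  by exact (Ccontinuous_mult _ _ t He K3).
split; [exact (Ccontinuous_mult _ _ t K4 K6)|].
assert (K7 : Ccontinuous (fun t => e t - 2 * s t * b)%C t).
{ exact (Ccontinuous_minus _ _ t He (Ccontinuous_mult _ _ t
    (Ccontinuous_mult _ _ t (Ccontinuous_const 2%C t) Hs) (Ccontinuous_const b t))). }
exact (Ccontinuous_plus _ _ t
  (Ccontinuous_mult _ _ t (Ccontinuous_mult _ _ t K5 K7) K6)
  (Ccontinuous_mult _ _ t K4 (Ccontinuous_mult _ _ t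
    (Ccontinuous_mult _ _ t He (Ccontinuous_const b t)) (Ccontinuous_mult _ _ t K3 K3)))).
Qed.

(** Derivatives in [s] at 0 and 1 are two-sided, so [s] must be allowed slightly outside [[0, 1]].
    With these margins the curve stays within [5/4 r] of [z0] for [s <= 1] and within
    [(9/16 + 5/4) r] beyond, below the radius [2 * r] on which [f] is given. *)
Lemma admissible_circle (b : C) (s t : R) :
  Cmod b < r -> -1/4 < s < 5/4 -> Rabs s * Cmod b < r ->
  admissible b s (circle r t).
Proof.
intros Hb Hs Hsb. assert (He := Cmod_circle r t ltac:(lra)).
assert (Pb := Cmod_ge_0 b).
split.
- unfold homotopy.
  replace (z0 + b + s * (circle r t - s * b) - z0)%C
    with ((1 - s * s)%R * b + s * circle r t)%C
    by (rewrite RtoC_minus, RtoC_mult; ring).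
  eapply Rle_lt_trans; [apply Cmod_triangle|].
  rewrite !Cmod_mult, !Cmod_R, He.
  destruct (Rle_dec s 1) as [H1|H1].
  + rewrite (Rabs_pos_eq (1 - s * s)) by nra.
    assert (Rabs s <= 1) by (apply Rabs_le; lra). nra.
  + rewrite (Rabs_left1 (1 - s * s)) by nra. rewrite (Rabs_pos_eq s) by lra.
    assert (- (1 - s * s) <= 9 / 16) by nra. nra.
- intros H. apply Ceq_minus in H. apply (f_equal Cmod) in H.
  rewrite He, Cmod_mult, Cmod_R in H. lra.
Qed.

(** The derivative passes under the integral sign, and for [s <> 0] the differentiated integrand has
    a primitive that is periodic in the angle. At [s = 0], where that primitive has [s] in its
    denominator, differentiability still yields the continuity that the mean value theorem asks
    for. *)
Lemma homotopy_invariance (p : C -> R) (b : C) (s : R) :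
  (p = Re \/ p = Im) -> Cmod b < r -> 0 <= s <= 1 ->
  is_derive (fun s : R => RInt (fun t => p (cauchy_integrand b s (circle r t))) 0 (2 * PI))
    s (RInt (fun t => p (cauchy_integrand_ds b s (circle r t))) 0 (2 * PI)) /\
  (s <> 0 -> RInt (fun t => p (cauchy_integrand_ds b s (circle r t))) 0 (2 * PI) = 0).
Proof.
intros Hp Hb Hs.
assert (Pb := Cmod_ge_0 b).
assert (Pc : forall z, @continuous Cspace R_UniformSpace p z)
  by (destruct Hp as [-> | ->]; [exact continuous_Re | exact continuous_Im]).
assert (Pd : forall (g : R -> C) t l, is_path_derive g t l ->
   is_derive (fun s => p (g s)) t (p l))
  by (destruct Hp as [-> | ->]; intros g t l [H1 H2]; assumption).
assert (ok0 : forall s' : R, 0 <= s' <= 1 -> locally s' (fun u : R =>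
   forall t, admissible b u (circle r t))).
{ intros s' Hs'.
  (* The first bound keeps [u] in the range [-1/4 < u < 5/4]; the second gives [|u| |b| < r], so
     that the kernel has no pole on the circle. *)
  assert (Hd : 0 < Rmin (1 / 4) ((r - Cmod b) / (Cmod b + 1))).
  { apply Rmin_pos; [lra|]. apply Rdiv_lt_0_compat; lra. }
  exists (mkposreal _ Hd). intros u Hu t.
  change (Rabs (u - s') < Rmin (1 / 4) ((r - Cmod b) / (Cmod b + 1))) in Hu.
  assert (H1 := Rlt_le_trans _ _ _ Hu (Rmin_l _ _)).
  assert (H2 := Rlt_le_trans _ _ _ Hu (Rmin_r _ _)).
  apply Rabs_def2 in H1.
  apply admissible_circle; auto; [lra|].
  assert (Rabs u <= 1 + Rabs (u - s')).
  { replace u with (s' + (u - s')) at 1 by ring.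
    eapply Rle_trans; [apply Rabs_triang|]. rewrite (Rabs_pos_eq s'); lra. }
  assert (Rabs (u - s') * (Cmod b + 1) < r - Cmod b).
  { apply Rmult_lt_reg_r with (/ (Cmod b + 1)); [apply Rinv_0_lt_compat; lra|].
    rewrite Rmult_assoc, Rinv_r by lra. rewrite Rmult_1_r. exact H2. }
  assert (P := Rabs_pos (u - s')). nra. }
assert (ok := ok0 s Hs).
assert (Dp : forall (u t : R), admissible b u (circle r t) ->
  is_derive (fun s : R => p (cauchy_integrand b s (circle r t))) u
    (p (cauchy_integrand_ds b u (circle r t)))).
{ intros u t Hu.
  apply (Pd (fun s : R => cauchy_integrand b s (circle r t))).
  replace (cauchy_integrand_ds b u (circle r t))
    with (cauchy_integrand_ds b u (circle r t) * (1 - 0))%C by ring.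
  apply (is_path_derive_comp (fun s => cauchy_integrand b s (circle r t)) RtoC).
  - now apply cauchy_integrand_derive.
  - assert (L := is_path_derive_segment 0 1 u).
    destruct L as [L1 L2]; split; (eapply is_derive_ext; [|eassumption]);
      intros v; cbv beta; f_equal; ring. }
assert (C2 : forall (u t : R), admissible b u (circle r t) ->
  continuous (fun q : R * R => p (cauchy_integrand_ds b (fst q) (circle r (snd q)))) (u, t)).
{ intros u t Hu.
  apply (@continuous_comp _ Cspace R_UniformSpace
    (fun q : R * R => cauchy_integrand_ds b (fst q) (circle r (snd q))) p); auto.
  apply (cauchy_integrand_continuous b (fun q : R * R => RtoC (fst q))
    (fun q : R * R => circle r (snd q)) (u, t)); auto.
  - apply continuous_C_pair; [apply continuous_fst | apply continuous_const].
  - apply (@continuous_comp _ R_UniformSpace Cspace snd (circle r)).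
    + apply continuous_snd.
    + apply circle_continuous. }
assert (Ct : forall u : R, (forall t, admissible b u (circle r t)) -> forall t : R,
  continuous (fun t => p (cauchy_integrand b u (circle r t))) t /\
  continuous (fun t => p (cauchy_integrand_ds b u (circle r t))) t).
{ intros u Hu t.
  destruct (cauchy_integrand_continuous b (fun _ : R => RtoC u) (circle r) t) as [A B];
    auto; [apply Ccontinuous_const | apply circle_continuous |].
  split.
  - exact (@continuous_comp _ Cspace R_UniformSpace _ p t A (Pc _)).
  - exact (@continuous_comp _ Cspace R_UniformSpace _ p t B (Pc _)). }
split.
- assert (D := is_derive_RInt_param
    (fun u t => p (cauchy_integrand b u (circle r t))) 0 (2 * PI) s).
  evar_last; [apply D|].
  + revert ok. apply filter_imp. intros u Hu t _. eexists. apply Dp. apply Hu.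
  + intros t _. apply continuity_2d_pt_filterlim.
    assert (E : locally (s, t) (fun q : R * R =>
      p (cauchy_integrand_ds b (fst q) (circle r (snd q))) =
      Derive (fun z : R => p (cauchy_integrand b z (circle r (snd q)))) (fst q))).
    { destruct ok as [d Hd]. exists d. intros q [Hq _].
      symmetry. apply is_derive_unique. apply Dp. now apply Hd. }
    apply (continuous_ext_loc _ _ _ E). apply C2. now apply locally_singleton in ok.
  + revert ok. apply filter_imp. intros u Hu.
    apply (ex_RInt_continuous (V := R_CompleteNormedModule)). intros t _. exact (proj1 (Ct u Hu t)).
  + apply RInt_ext. intros t _. apply is_derive_unique. apply Dp.
    now apply locally_singleton in ok.
- intros Hs0. apply locally_singleton in ok.
  set (K := fun t : R => (/ (Ci * s) * (f (homotopy b s (circle r t)) *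
    ((circle r t - 2 * s * b) * / (circle r t - s * b))))%C).
  assert (DK : forall t, is_derive (fun t => p (K t)) t
     (p (cauchy_integrand_ds b s (circle r t)))).
  { intros t. apply (Pd K).
    assert (He : circle r t <> 0%C).
    { apply Cmod_gt_0. rewrite Cmod_circle; lra. }
    replace (cauchy_integrand_ds b s (circle r t))
      with (/ (Ci * circle r t) * cauchy_integrand_ds b s (circle r t)
        * (Ci * circle r t))%C by (assert (Hi := Ci_nz); field; auto).
    apply (is_path_derive_comp (fun e => / (Ci * s) * (f (homotopy b s e) *
      ((e - 2 * s * b) * / (e - s * b))))%C (circle r)).
    - apply cauchy_primitive_derive; auto. intros H. apply Hs0. now apply RtoC_inj.
    - apply circle_derive. }
  apply (is_RInt_unique (V := R_CompleteNormedModule)).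
  replace 0 with (minus (p (K (2 * PI))) (p (K 0))) at 2.
  + apply (is_RInt_derive (V := R_CompleteNormedModule) (fun t => p (K t))).
    * intros t _. apply DK.
    * intros t _. exact (proj2 (Ct s ok t)).
  + unfold K. rewrite circle_period. exact (minus_eq_zero (G := R_AbelianGroup) _).
Qed.

Lemma cauchy_formula (b : C) : Cmod b < r ->
  Ccircle_int (fun t => f (z0 + circle r t) * (circle r t * / (circle r t - b)))%C
  = (RtoC (2 * PI) * f (z0 + b))%C.
Proof.
intros Hb.
assert (He : forall t, circle r t <> 0%C).
{ intros t. apply Cmod_gt_0. rewrite Cmod_circle; lra. }
assert (key : forall p : C -> R, (p = Re \/ p = Im) ->
  RInt (fun t => p (cauchy_integrand b 1 (circle r t))) 0 (2 * PI) =
  RInt (fun t => p (cauchy_integrand b 0 (circle r t))) 0 (2 * PI)).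
{ intros p Hp.
  destruct (MVT_gen (fun s : R => RInt (fun t => p (cauchy_integrand b s (circle r t)))
    0 (2 * PI)) 0 1 (fun _ => 0)) as [c [_ Hc]].
  - intros s Hs. rewrite Rmin_left, Rmax_right in Hs by lra.
    destruct (homotopy_invariance p b s Hp Hb ltac:(lra)) as [D E].
    rewrite E in D by lra. exact D.
  - intros s Hs. rewrite Rmin_left, Rmax_right in Hs by lra.
    apply continuity_pt_filterlim.
    destruct (homotopy_invariance p b s Hp Hb Hs) as [D _].
    exact (ex_derive_continuous (V := R_NormedModule) _ s (ex_intro _ _ D)).
  - lra. }
assert (E1 : forall t, cauchy_integrand b 1 (circle r t) =
  (f (z0 + circle r t) * (circle r t * / (circle r t - b)))%C).
{ intros t. unfold cauchy_integrand, homotopy.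
  replace (z0 + b + 1 * (circle r t - 1 * b))%C with (z0 + circle r t)%C by ring.
  now replace (circle r t - 1 * b)%C with (circle r t - b)%C by ring. }
(* At [s = 0] the kernel is [e / e = 1] and the integrand is constant. This is the benefit of [s b]
   in the homotopy: plain shrinking towards [z0 + b] would leave the integral of [e / (e - b)] to be
   computed. *)
assert (E0 : forall t, cauchy_integrand b 0 (circle r t) = f (z0 + b)%C).
{ intros t. unfold cauchy_integrand, homotopy.
  replace (z0 + b + 0 * (circle r t - 0 * b))%C with (z0 + b)%C by ring.
  replace (circle r t - 0 * b)%C with (circle r t) by ring. field. apply He. }
rewrite <- (Ccircle_int_ext _ _ E1). unfold Ccircle_int.
rewrite (key Re (or_introl eq_refl)), (key Im (or_intror eq_refl)).
rewrite (RInt_ext (fun t => Re (cauchy_integrand b 0 (circle r t)))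
  (fun _ => Re (f (z0 + b)%C))) by (intros; now rewrite E0).
rewrite (RInt_ext (fun t => Im (cauchy_integrand b 0 (circle r t)))
  (fun _ => Im (f (z0 + b)%C))) by (intros; now rewrite E0).
rewrite !RInt_const. unfold scal, RtoC, Cmult, Re, Im. simpl. unfold mult. simpl.
f_equal; ring.
Qed.

(** [F n] is Cauchy's formula for the derivative of order [n]: [n!] times the integral of [phi]
    against the kernel to the power [n + 1], [phi] collecting the factors independent of [z].
    Differentiating the kernel under the integral leads from each [F n] to the next. *)
Lemma holomorphic_C1_smooth :
  exists F : nat -> C -> C, forall z, Cmod (z - z0) < r ->
    F O z = f z /\ forall n, is_Cderive (F n) z (F (S n) z).
Proof.
assert (HPI := PI_RGT_0).
set (phi := fun t => (/ RtoC (2 * PI) * (f (z0 + circle r t) * circle r t))%C).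
set (F := fun (n : nat) (z : C) => (RtoC (INR (fact n)) *
  Ccircle_int (fun t => phi t * (/ (circle r t - (z - z0))) ^ S n)%C)%C).
assert (Cphi : forall t, @continuous R_UniformSpace Cspace phi t).
{ intros t. apply Ccontinuous_mult; [apply Ccontinuous_const|].
  apply Ccontinuous_mult; [|apply circle_continuous].
  apply (Ccontinuous_comp f (fun t => z0 + circle r t)%C).
  - eapply is_Cderive_continuous. apply f_C1.
    replace (z0 + circle r t - z0)%C with (circle r t) by ring.
    rewrite Cmod_circle; lra.
  - apply Ccontinuous_plus; [apply Ccontinuous_const | apply circle_continuous]. }
assert (Bphi : exists P, 0 <= P /\ forall t, 0 <= t <= 2 * PI -> Cmod (phi t) <= P).
{ destruct (bounded_continuity (V := C_R_NormedModule) phi 0 (2 * PI)) as [P HP].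
  - intros t _. intros Q HQ. apply (Cphi t). now apply locally_C.
  - assert (HP' : forall t, 0 <= t <= 2 * PI -> Cmod (phi t) <= P).
    { intros t Ht. left. rewrite Cmod_norm. exact (HP t Ht). }
    exists P. split; auto.
    apply Rle_trans with (Cmod (phi 0)); [apply Cmod_ge_0 | apply HP'; lra]. }
destruct Bphi as [P [HP0 HP]].
assert (Hne : forall z t, Cmod (z - z0) < r -> (circle r t - (z - z0) <> 0)%C).
{ intros z t Hz H. apply Ceq_minus in H. apply (f_equal Cmod) in H.
  rewrite Cmod_circle in H; lra. }
assert (Ck : forall n z, Cmod (z - z0) < r -> forall t, @continuous R_UniformSpace Cspace
  (fun t => phi t * (/ (circle r t - (z - z0))) ^ n)%C t).
{ intros n z Hz t. apply (Ccontinuous_mult _ _ t (Cphi t)).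
  apply (Ccontinuous_pow (fun t => / (circle r t - (z - z0)))%C t n).
  apply (Ccontinuous_inv (fun t => circle r t - (z - z0))%C); auto.
  exact (Ccontinuous_minus _ _ t (circle_continuous r t) (Ccontinuous_const _ t)). }
exists F. intros z Hz. split.
- unfold F. change (INR (fact 0)) with 1. rewrite Cmult_1_l.
  replace (f z) with (/ RtoC (2 * PI) * (RtoC (2 * PI) * f (z0 + (z - z0))))%C.
  + rewrite <- cauchy_formula by exact Hz.
    rewrite <- Ccircle_int_scal.
    * apply Ccircle_int_ext. intros t. unfold phi. simpl. ring.
    * intros t. apply (continuous_ext (T := R_UniformSpace) (U := Cspace)
        (fun t => RtoC (2 * PI) * (phi t * (/ (circle r t - (z - z0))) ^ 1))%C).
      -- intros u. unfold phi. simpl. field. split; [apply Hne; auto|].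
         intros H. apply RtoC_inj in H. lra.
      -- exact (Ccontinuous_mult _ _ t (Ccontinuous_const _ t) (Ck 1%nat z Hz t)).
  + replace (z0 + (z - z0))%C with z by ring. field.
    intros H. apply RtoC_inj in H. lra.
- intros n. apply is_Cderive_iff. intros eps Heps.
  (* [/ k] is half the distance from [z] to the circle, so for [w] within [/ k] of [z] the kernels
     at [z] and at [w] are both bounded by [k]. *)
  set (k := 2 / (r - Cmod (z - z0))).
  assert (Hk : 0 < k) by (apply Rdiv_lt_0_compat; lra).
  destruct (pow_remainder (S n) k ltac:(lra)) as [M [HM HR]].
  (* [L] bounds the Taylor remainder of [F n] by [L |w - z|^2]; [L + 1] in the radius below avoids a
     division by zero. *)
  set (L := INR (fact n) * (4 * PI * (P * M))).
  assert (HL : 0 <= L).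
  { apply Rmult_le_pos; [apply pos_INR|].
    apply Rmult_le_pos; [lra | now apply Rmult_le_pos]. }
  exists (Rmin (/ k) (eps / (L + 1))). split.
  { apply Rmin_pos; [now apply Rinv_0_lt_compat | apply Rdiv_lt_0_compat; lra]. }
  intros w Hw.
  assert (Hw1 := Rlt_le_trans _ _ _ Hw (Rmin_l _ _)).
  assert (Hw2 := Rlt_le_trans _ _ _ Hw (Rmin_r _ _)).
  assert (Ek : / k = (r - Cmod (z - z0)) / 2) by (unfold k; field; lra).
  assert (Hwz : Cmod (w - z0) <= r - / k).
  { replace (w - z0)%C with ((w - z) + (z - z0))%C by ring.
    eapply Rle_trans; [apply Cmod_triangle|]. lra. }
  assert (Hik : 0 < / k) by now apply Rinv_0_lt_compat.
  assert (Hwr : Cmod (w - z0) < r) by lra.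
  assert (Hinv : forall v t, Cmod (v - z0) <= r - / k ->
    Cmod (/ (circle r t - (v - z0))) <= k).
  { intros v t Hv.
    assert (H : / k <= Cmod (circle r t - (v - z0))).
    { generalize (Cmod_triangle_minus (circle r t) (v - z0)).
      rewrite Cmod_circle; lra. }
    rewrite Cmod_inv by (apply Cmod_gt_0; lra).
    rewrite <- (Rinv_inv k). now apply Rinv_le_contravar. }
  set (K := fun (v : C) (m : nat) (t : R) => (phi t * (/ (circle r t - (v - z0))) ^ m)%C).
  assert (EF : (F n w - F n z - F (S n) z * (w - z) = RtoC (INR (fact n)) *
    Ccircle_int (fun t => K w (S n) t + - 1 * K z (S n) t
       + (- (w - z) * INR (S n)) * K z (S (S n)) t))%C).
  { assert (C1 := Ck (S n) w Hwr). assert (C2 := Ck (S n) z Hz).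
    assert (C3 := Ck (S (S n)) z Hz). fold (K w (S n)) in C1. fold (K z (S n)) in C2.
    fold (K z (S (S n))) in C3.
    assert (C2' : forall t, @continuous R_UniformSpace Cspace
      (fun t => - 1 * K z (S n) t)%C t)
      by (intros t; exact (Ccontinuous_mult _ _ t (Ccontinuous_const _ t) (C2 t))).
    assert (C3' : forall t, @continuous R_UniformSpace Cspace
      (fun t => (- (w - z) * INR (S n)) * K z (S (S n)) t)%C t)
      by (intros t; exact (Ccontinuous_mult _ _ t (Ccontinuous_const _ t) (C3 t))).
    rewrite (Ccircle_int_plus (fun t => K w (S n) t + - 1 * K z (S n) t)%C); auto;
      [|intros t; exact (Ccontinuous_plus _ _ t (C1 t) (C2' t))].
    rewrite Ccircle_int_plus, !Ccircle_int_scal by auto.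
    unfold F. fold (K w (S n)) (K z (S n)) (K z (S (S n))).
    rewrite fact_simpl, mult_INR, RtoC_mult. ring. }
  rewrite EF, Cmod_mult, Cmod_R, Rabs_pos_eq by apply pos_INR.
  apply Rle_trans with (L * Cmod (w - z) ^ 2).
  + unfold L. rewrite Rmult_assoc. apply Rmult_le_compat_l; [apply pos_INR|].
    rewrite Rmult_assoc. apply Ccircle_int_bound.
    * intros t.
      assert (C1 := Ck (S n) w Hwr t). assert (C2 := Ck (S n) z Hz t).
      assert (C3 := Ck (S (S n)) z Hz t).
      exact (Ccontinuous_plus _ _ t (Ccontinuous_plus _ _ t C1
        (Ccontinuous_mult _ _ t (Ccontinuous_const _ t) C2))
        (Ccontinuous_mult _ _ t (Ccontinuous_const _ t) C3)).
    * intros t Ht. unfold K.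
      set (x := (/ (circle r t - (z - z0)))%C). set (y := (/ (circle r t - (w - z0)))%C).
      replace (phi t * y ^ S n + -1 * (phi t * x ^ S n)
          + - (w - z) * INR (S n) * (phi t * x ^ S (S n)))%C
        with (phi t * (y ^ S n - x ^ S n - (w - z) * (INR (S n) * x ^ S (S n))))%C by ring.
      rewrite Cmod_mult, Rmult_assoc. apply Rmult_le_compat; try apply Cmod_ge_0; auto.
      apply HR; try apply Hinv; try lra.
      unfold x, y. field. split; now apply Hne.
  + replace (L * Cmod (w - z) ^ 2) with ((L * Cmod (w - z)) * Cmod (w - z)) by ring.
    apply Rmult_le_compat_r; [apply Cmod_ge_0|].
    assert (H : Cmod (w - z) * (L + 1) < eps).
    { apply Rmult_lt_reg_r with (/ (L + 1)); [apply Rinv_0_lt_compat; lra|].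
      rewrite Rmult_assoc, Rinv_r, Rmult_1_r by lra. exact Hw2. }
    generalize (Cmod_ge_0 (w - z)). nra.
Qed.

End Cauchy.

(** * The complex case *)

Lemma is_Cderive_ext_disc (f g : C -> C) (a z l : C) (r : R) :
  Cmod (z - a) < r -> (forall w, Cmod (w - a) < r -> f w = g w) ->
  is_Cderive f z l -> is_Cderive g z l.
Proof.
intros Hz Hfg. apply (is_derive_ext_loc (V := AbsRing_NormedModule C_AbsRing)).
apply locally_Cmod. exists (r - Cmod (z - a)). split; [lra|]. intros w Hw.
apply Hfg. replace (w - a)%C with ((w - z) + (z - a))%C by ring.
eapply Rle_lt_trans; [apply Cmod_triangle|]. lra.
Qed.

(* The inverse [tau] of the flow in time has derivative [1 / X], which is
   continuous, so that Cauchy's formula applies to [tau]. *)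
Lemma flow_time_primitive (U : C -> Prop) (X : C -> C) (E : C -> C -> C) (x : C) :
  holomorphic_on U X -> @is_local_flow C_AbsRing U X E -> U x -> X x <> 0%C ->
  exists (F : nat -> C -> C) (r : R), 0 < r /\ forall z, Cmod (z - x) < r ->
    U z /\ X z <> 0%C /\ F 1%nat z = (/ X z)%C /\
    forall n, is_Cderive (F n) z (F (S n) z).
Proof.
intros HX HE Ux Xx. destruct (HE x Ux) as [E0 Hfl].
change (E 0%C x = x) in E0.
change (@locally Cspace (RtoC 0) (fun t => U (E t x) /\
  is_Cderive (fun s => E s x) t (X (E t x)))) in Hfl.
apply locally_Cmod in Hfl. destruct Hfl as [r [Hr Hfl]].
assert (CX : forall z, U z -> @continuous Cspace Cspace X z).
{ intros z Uz. destruct (HX z Uz) as [l Hl]. exact (is_Cderive_continuous X z l Hl). }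
assert (z0 : Cmod (0 - 0) < r) by (replace (0 - 0)%C with (RtoC 0) by ring; now rewrite Cmod_0).
destruct (local_inverse (fun t => E t x) (fun t => X (E t x)) 0%C r Hr)
  as [tau [d [Hd Htau]]].
- intros t Ht. now apply Hfl.
- apply (@Ccontinuous_comp Cspace X (fun t => E t x)).
  + apply CX. now apply Hfl.
  + eapply is_Cderive_continuous. now apply Hfl.
- now rewrite E0.
- rewrite E0 in Htau.
  assert (Hn := @locally_neq Cspace C_AbsRing X x (RtoC 0) (CX x Ux) Xx).
  apply locally_Cmod in Hn. destruct Hn as [d' [Hd' Hn]].
  (* Halved because Cauchy's formula on the disc of radius [q] needs the function on the disc of
     radius [2 * q]. *)
  set (q := Rmin d d' / 2).
  assert (Hq : 0 < q) by (apply Rdiv_lt_0_compat; [now apply Rmin_pos | lra]).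
  assert (Hqd : 2 * q <= d) by (unfold q; generalize (Rmin_l d d'); lra).
  assert (Hqd' : 2 * q <= d') by (unfold q; generalize (Rmin_r d d'); lra).
  assert (HU : forall z, Cmod (z - x) < 2 * q ->
    U z /\ X z <> 0%C /\ is_Cderive tau z (/ X z)%C).
  { intros z Hz. destruct (Htau z ltac:(lra)) as [T1 [T2 T3]]. rewrite T2 in T3.
    split; [|split; auto].
    - rewrite <- T2. now apply Hfl.
    - apply Hn. lra. }
  destruct (holomorphic_C1_smooth tau (fun z => / X z)%C x q Hq) as [F HF].
  { intros z Hz. destruct (HU z Hz) as [Uz [Xz D]]. split; auto.
    apply (@Ccontinuous_inv Cspace X z); auto. }
  exists F, q. split; auto. intros z Hz.
  destruct (HU z ltac:(lra)) as [Uz [Xz D]]. destruct (HF z Hz) as [_ DF].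
  split; [|split; [|split]]; auto.
  apply (is_Cderive_unique tau z); auto.
  apply (is_Cderive_ext_disc (F O) tau x z _ q); auto.
  intros w Hw. now apply HF.
Qed.

(** Near [x] the field is [I = 1 / F 1], the inverse of a nonvanishing smooth function, so its
    derivatives are rational in [F 1], [F 2], [F 3]: [X1] and [X2] are these expressions for the
    first two. They agree with the iterated [C_derive] on a whole disc, as differentiating again
    requires. *)
Lemma flow_field_smooth (U : C -> Prop) (X : C -> C) (E : C -> C -> C) (x : C) :
  holomorphic_on U X -> @is_local_flow C_AbsRing U X E -> U x -> X x <> 0%C ->
  is_Cderive (C_derive X) x (C_derive (C_derive X) x) /\
  is_Cderive (C_derive (C_derive X)) x (C_derive (C_derive (C_derive X)) x).
Proof.
intros HX HE Ux Xx.
destruct (flow_time_primitive U X E x HX HE Ux Xx) as [F [r [Hr HF]]].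
assert (Hx : Cmod (x - x) < r) by (replace (x - x)%C with (RtoC 0) by ring; now rewrite Cmod_0).
set (I := fun z => (/ F 1%nat z)%C).
assert (F0 : forall z, Cmod (z - x) < r -> F 1%nat z <> 0%C).
{ intros z Hz. destruct (HF z Hz) as [_ [Xz [-> _]]]. intros H. apply Xz.
  rewrite <- (Cmult_1_r (X z)), <- (Cinv_l (X z)) by auto. rewrite H. ring. }
assert (DI : forall z, Cmod (z - x) < r -> is_Cderive I z (- F 2%nat z * (I z * I z))%C).
{ intros z Hz. unfold I.
  replace (- F 2%nat z * (/ F 1%nat z * / F 1%nat z))%C
    with (- F 2%nat z / (F 1%nat z * F 1%nat z))%C by (field; auto).
  apply is_Cderive_inv; auto. now apply HF. }
set (X1 := fun z => (- (1) * (F 2%nat z * (I z * I z)))%C).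
set (X2 := fun z => (- (1) * (F 3%nat z * (I z * I z))
   + 2 * (F 2%nat z * F 2%nat z * (I z * (I z * I z))))%C).
assert (DX : forall z, Cmod (z - x) < r -> is_Cderive X z (X1 z)).
{ intros z Hz. apply (is_Cderive_ext_disc I X x z _ r); auto.
  - intros w Hw. unfold I. destruct (HF w Hw) as [_ [Xw [-> _]]]. now field.
  - replace (X1 z) with (- F 2%nat z * (I z * I z))%C by (unfold X1; ring). auto. }
assert (DX1 : forall z, Cmod (z - x) < r -> is_Cderive X1 z (X2 z)).
{ intros z Hz.
  assert (D := is_Cderive_mult _ _ _ _ _ (is_Cderive_const (- (1))%C z)
    (is_Cderive_mult _ _ _ _ _ (proj2 (proj2 (proj2 (HF z Hz))) 2%nat)
      (is_Cderive_mult _ _ _ _ _ (DI z Hz) (DI z Hz)))).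
  match type of D with is_Cderive _ _ ?l => replace (X2 z) with l; [exact D|] end.
  unfold X2. ring. }
assert (DX2 : exists l, is_Cderive X2 x l).
{ assert (D3 := proj2 (proj2 (proj2 (HF x Hx))) 3%nat).
  assert (D2 := proj2 (proj2 (proj2 (HF x Hx))) 2%nat).
  assert (D1 := DI x Hx).
  eexists. apply is_Cderive_plus; (apply is_Cderive_mult; [apply is_Cderive_const|]).
  - exact (is_Cderive_mult _ _ _ _ _ D3 (is_Cderive_mult _ _ _ _ _ D1 D1)).
  - exact (is_Cderive_mult _ _ _ _ _ (is_Cderive_mult _ _ _ _ _ D2 D2)
      (is_Cderive_mult _ _ _ _ _ D1 (is_Cderive_mult _ _ _ _ _ D1 D1))). }
assert (E1 : forall z, Cmod (z - x) < r -> X1 z = C_derive X z)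
  by (intros z Hz; symmetry; apply is_Cderive_C_derive; auto).
assert (D1 : forall z, Cmod (z - x) < r -> is_Cderive (C_derive X) z (X2 z)).
{ intros z Hz. apply (is_Cderive_ext_disc X1 _ x z _ r); auto. }
assert (E2 : forall z, Cmod (z - x) < r -> X2 z = C_derive (C_derive X) z)
  by (intros z Hz; symmetry; apply is_Cderive_C_derive; auto).
split.
- eapply C_derive_is_Cderive. now apply D1.
- destruct DX2 as [l Hl]. apply (C_derive_is_Cderive _ _ l).
  now apply (is_Cderive_ext_disc X2 _ x x l r).
Qed.

(** * Functions whose second derivative vanishes off their zeros *)

Lemma is_Cderive_sub_linear (f : C -> C) (k z l : C) :
  is_Cderive f z l -> is_Cderive (fun w => f w - k * w)%C z (l - k)%C.
Proof.
intros H. apply is_Cderive_minus; auto.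
replace k with (0 * z + k * 1)%C at 2 by ring.
apply (is_Cderive_mult (fun _ => k) (fun w => w));
  [apply is_Cderive_const | apply is_Cderive_id].
Qed.

(* Near a simple zero of [b], [b] is affine along each radius, and the slope at the
   zero determines it. *)
Lemma affine_near_simple_zero (b b1 : C -> C) (z : C) (r : R) :
  0 < r -> b z = 0%C -> b1 z <> 0%C ->
  (forall w, Cmod (w - z) < r -> is_Cderive b w (b1 w)) ->
  (forall w, Cmod (w - z) < r -> b w <> 0%C -> is_Cderive b1 w 0%C) ->
  exists d, 0 < d /\ forall w, Cmod (w - z) < d ->
    b1 w = b1 z /\ b w = (b1 z * (w - z))%C.
Proof.
intros Hr b0 Hl Db Db1. set (l := b1 z) in *.
assert (Hz : Cmod (z - z) < r) by (replace (z - z)%C with (RtoC 0) by ring; now rewrite Cmod_0).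
assert (Ml : 0 < Cmod l) by now apply Cmod_gt_0.
assert (Dz : forall eps : R, 0 < eps -> exists d : R, 0 < d /\ forall w,
  Cmod (w - z) < d -> Cmod (b w - l * (w - z)) <= eps * Cmod (w - z)).
{ intros eps Heps. destruct (proj1 (is_Cderive_iff _ _ _) (Db z Hz) eps Heps) as [d [Hd H]].
  exists d. split; auto. intros w Hw. generalize (H w Hw). rewrite b0.
  now replace (b w - 0 - b1 z * (w - z))%C with (b w - l * (w - z))%C by (unfold l; ring). }
(* With an error below half the linear term, [b] has no zero other than [z] on this disc, so [b1] is
   constant along each radius away from [z]. *)
destruct (Dz (Cmod l / 2) ltac:(lra)) as [d [Hd HD]].
exists (Rmin r d). split; [now apply Rmin_pos|]. intros w Hw.
assert (Hwr := Rlt_le_trans _ _ _ Hw (Rmin_l _ _)).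
assert (Hwd := Rlt_le_trans _ _ _ Hw (Rmin_r _ _)).
destruct (Ceq_dec w z) as [->|Hwz].
{ split; auto. rewrite b0. ring. }
assert (Mw : 0 < Cmod (w - z)) by (apply Cmod_gt_0; now apply Cminus_eq_contra).
set (p := fun s : R => (z + s * (w - z))%C).
assert (Ep : forall s, 0 <= s -> Cmod (p s - z) = s * Cmod (w - z)).
{ intros s Hs. unfold p. replace (z + s * (w - z) - z)%C with (s * (w - z))%C by ring.
  now rewrite Cmod_mult, Cmod_R, Rabs_pos_eq. }
assert (Hpr : forall s, 0 <= s <= 1 -> Cmod (p s - z) < r).
{ intros s Hs. rewrite Ep by lra. nra. }
assert (Hb : forall s, 0 < s <= 1 -> b (p s) <> 0%C).
{ intros s Hs H. assert (A := HD (p s)). rewrite H, Ep in A by lra.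
  specialize (A ltac:(nra)).
  replace (0 - l * (p s - z))%C with (- (l * (p s - z)))%C in A by ring.
  rewrite Cmod_opp, Cmod_mult, Ep in A by lra.
  assert (0 < s * Cmod (w - z)) by nra. nra. }
set (k := b1 w).
assert (Hk : forall s, 0 < s <= 1 -> b1 (p s) = k).
{ intros s Hs. symmetry. apply Ceq_minus, Cmod_eq_0.
  apply Rle_antisym; [|apply Cmod_ge_0].
  replace 0 with (2 * 0 * Cmod (w - p s)) by ring.
  assert (Eq : forall t : R, (p s + t * (w - p s))%C = p (s + t * (1 - s))).
  { intros t. unfold p. rewrite RtoC_plus, RtoC_mult, RtoC_minus. ring. }
  apply (mean_value_C b1 (fun _ => 0%C)).
  - intros t Ht. rewrite Eq. assert (0 < s + t * (1 - s) <= 1) by nra.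
    split; [|rewrite Cmod_0; lra]. apply Db1; [apply Hpr; lra | now apply Hb].
  - intros t Ht. rewrite Eq. assert (0 < s + t * (1 - s) <= 1) by nra.
    apply (is_Cderive_continuous _ _ 0%C). apply Db1; [apply Hpr; lra | now apply Hb]. }
assert (Hbk : forall s, 0 < s <= 1 -> b (p s) = (k * (s * (w - z)))%C).
{ intros s Hs.
  assert (H : ((b (p s) - k * p s) - (b z - k * z) = 0)%C).
  { apply Cmod_eq_0. apply Rle_antisym; [|apply Cmod_ge_0].
    replace 0 with (2 * 0 * Cmod (p s - z)) by ring.
    assert (Eq : forall t : R, (z + t * (p s - z))%C = p (t * s)).
    { intros t. unfold p. rewrite RtoC_mult. ring. }
    apply (mean_value_C (fun w => b w - k * w)%C (fun w => b1 w - k)%C).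
    - intros t Ht. rewrite Eq. assert (0 < t * s <= 1) by nra. split.
      + apply is_Cderive_sub_linear. apply Db, Hpr. lra.
      + rewrite Hk by auto. replace (k - k)%C with (RtoC 0) by ring. rewrite Cmod_0; lra.
    - intros t Ht. rewrite Eq. assert (0 <= t * s <= 1) by nra.
      eapply is_Cderive_continuous. apply is_Cderive_sub_linear. apply Db, Hpr. lra. }
  rewrite b0 in H. apply Ceq_minus in H. unfold p in H |- *.
  transitivity ((b (z + s * (w - z)) - k * (z + s * (w - z)))
    + k * (z + s * (w - z)))%C; [ring | rewrite H; ring]. }
(* [b1] is not known to be continuous at [z], so the slope [k] of the radius is compared with [l]
   through the difference quotient of [b] at [z], along points [p s] close to [z]. *)
assert (Ekl : k = l).
{ apply Ceq_minus, Cmod_eq_0. apply Rle_antisym; [|apply Cmod_ge_0].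
  apply le_epsilon. intros eps Heps. rewrite Rplus_0_l.
  destruct (Dz eps Heps) as [d' [Hd' HD']].
  set (s := Rmin 1 (d' / (2 * Cmod (w - z)))).
  assert (Hs : 0 < s <= 1).
  { split; [|apply Rmin_l]. apply Rmin_pos; [lra|]. apply Rdiv_lt_0_compat; lra. }
  assert (Hs' : s * Cmod (w - z) < d').
  { apply Rle_lt_trans with (d' / (2 * Cmod (w - z)) * Cmod (w - z)).
    - apply Rmult_le_compat_r; [lra | apply Rmin_r].
    - replace (d' / (2 * Cmod (w - z)) * Cmod (w - z)) with (d' / 2) by (field; lra). lra. }
  assert (A := HD' (p s)). rewrite Ep in A by lra. specialize (A Hs').
  rewrite Hbk in A by auto.
  replace (k * (s * (w - z)) - l * (p s - z))%C with ((k - l) * (p s - z))%C in A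
    by (unfold p; ring).
  rewrite Cmod_mult, Ep in A by lra.
  apply Rmult_le_reg_r with (s * Cmod (w - z)); nra. }
split; auto.
assert (H1 := Hbk 1 ltac:(lra)). unfold p in H1.
replace (z + 1 * (w - z))%C with w in H1 by ring. rewrite H1, Ekl. ring.
Qed.

(** Agreement of value and slope with the tangent line at [z0] is locally constant. Where [b] is
    nonzero, it is affine nearby. At a zero of [b], agreement at [z] means a simple zero and the
    preceding lemma applies. Otherwise agreement fails in a whole neighbourhood: by continuity if
    the line does not vanish at [z], and by the derivative of [b] at [z] if the line vanishes there
    with another slope. *)
Lemma affine_of_second_derivative (U : C -> Prop) (b b1 : C -> C) :
  @open Cspace U -> @connected Cspace U ->
  (forall z, U z -> is_Cderive b z (b1 z)) ->
  (forall z, U z -> b z <> 0%C -> is_Cderive b1 z 0%C) ->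
  exists l m : C, forall z, U z -> b z = (l * z + m)%C.
Proof.
intros oU cU Db Db1.
destruct (classic (exists z, U z /\ b z <> 0%C)) as [[z0 [Uz0 Hz0]]|Hno].
2:{ exists 0%C, 0%C. intros z Uz. destruct (Ceq_dec (b z) 0) as [->|H]; [ring|].
    exfalso. apply Hno. eauto. }
set (l := b1 z0). set (m := (b z0 - l * z0)%C). exists l, m.
(* The line is nonzero at [z0], so it can vanish somewhere only with a nonzero slope; the zeros of
   [b] that have to be crossed are thus simple. *)
assert (Hm : forall z, (l * z + m = 0)%C -> l <> 0%C).
{ intros z H Hl. apply Hz0. transitivity (l * z0 + m)%C; [unfold m; ring|].
  rewrite <- H, Hl. ring. }
enough (H : forall z, U z -> b1 z = l /\ b z = (l * z + m)%C) by (intros; now apply H).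
intros z1 Uz1.
apply (@connected_propagation Cspace U (fun z => b1 z = l /\ b z = (l * z + m)%C) oU cU) with z0;
  auto; [|split; auto; unfold m; ring].
intros z Uz.
assert (Cb : @continuous Cspace Cspace b z)
  by (apply (is_Cderive_continuous _ _ _ (Db z Uz))).
destruct (Ceq_dec (b z) 0) as [b0|b0].
- destruct (Ceq_dec (l * z + m) 0) as [L0|L0].
  + assert (Em : m = (- l * z)%C) by (apply Ceq_minus; rewrite <- L0; ring).
    destruct (Ceq_dec (b1 z) l) as [E1|E1].
    * assert (HU := oU z Uz). apply locally_Cmod in HU. destruct HU as [r [Hr HU]].
      destruct (affine_near_simple_zero b b1 z r) as [d [Hd Hloc]]; auto.
      { rewrite E1. now apply (Hm z). }
      apply locally_Cmod. exists d. split; auto. intros w Hw.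
      destruct (Hloc w Hw) as [H1 H2]. rewrite E1 in H1, H2. rewrite Em.
      split; intros _; split; auto; [rewrite b0 | rewrite H2]; ring.
    * assert (Hp : 0 < Cmod (b1 z - l)) by (apply Cmod_gt_0; now apply Cminus_eq_contra).
      destruct (proj1 (is_Cderive_iff _ _ _) (Db z Uz) (Cmod (b1 z - l) / 2) ltac:(lra))
        as [d [Hd HD]].
      apply locally_Cmod. exists d. split; auto. intros w Hw.
      split; intros [H1 H2]; [exfalso|now elim E1].
      destruct (Ceq_dec w z) as [->|Hwz]; [now elim E1|].
      assert (A := HD w Hw). rewrite b0, H2, Em in A.
      replace (l * w + - l * z - 0 - b1 z * (w - z))%C
        with (- ((b1 z - l) * (w - z)))%C in A by ring.
      rewrite Cmod_opp, Cmod_mult in A.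
      assert (0 < Cmod (w - z)) by (apply Cmod_gt_0; now apply Cminus_eq_contra).
      nra.
  + assert (N : @locally Cspace z (fun w => (b w - (l * w + m) <> 0)%C)).
    { apply (@locally_neq Cspace C_AbsRing (fun w => b w - (l * w + m))%C z (RtoC 0)).
      - exact (@Ccontinuous_minus Cspace _ _ z Cb (@Ccontinuous_plus Cspace _ _ z
          (@Ccontinuous_mult Cspace _ _ z (@Ccontinuous_const Cspace l z)
            (is_Cderive_continuous _ _ _ (is_Cderive_id z)))
          (@Ccontinuous_const Cspace m z))).
      - rewrite b0. intros H. apply L0. transitivity (- (0 - (l * z + m)))%C; [ring|].
        rewrite H. ring. }
    revert N. apply filter_imp. intros w Hw.
    split; intros [_ H]; exfalso.
    * apply Hw. rewrite H. ring.
    * apply L0. now rewrite <- H.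
- assert (N : @locally Cspace z (fun w => U w /\ b w <> 0%C)).
  { apply (@filter_and _ (@locally Cspace z)); [apply _ | now apply oU|].
    now apply (@locally_neq Cspace C_AbsRing b z (RtoC 0)). }
  assert (N1 : @locally Cspace z (fun w => b1 w = b1 z)).
  { apply C_derive_zero. revert N. apply filter_imp. intros w [Uw Hw]. auto. }
  assert (N2 : @locally Cspace z (fun w => (b w - b1 z * w)%C = (b z - b1 z * z)%C)).
  { apply (C_derive_zero (fun w => b w - b1 z * w)%C).
    generalize (filter_and _ _ N N1). apply filter_imp. intros w [[Uw _] E].
    replace (RtoC 0) with (b1 w - b1 z)%C by (rewrite E; ring).
    apply is_Cderive_sub_linear. auto. }
  generalize (filter_and _ _ N1 N2). apply filter_imp. intros w [E1 E2].
  rewrite E1. split; intros [H1 H2]; split; auto; rewrite H1 in E2.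
  + transitivity ((b z - l * z) + l * z)%C; [ring | rewrite <- E2, H2; ring].
  + transitivity ((b w - l * w) + l * w)%C; [ring | rewrite E2, H2; ring].
Qed.

(** * Isotropic complex chambars and the square root form *)

Lemma open_Cspace (U : C -> Prop) : @open C_UniformSpace U <-> @open Cspace U.
Proof. split; intros H x Ux; apply locally_C; now apply H. Qed.

Lemma connected_Cspace (U : C -> Prop) :
  @connected C_UniformSpace U -> @connected Cspace U.
Proof. intros H A B oA oB. apply H; now apply open_Cspace. Qed.

Lemma affine_two_zeros (l m x y : C) :
  x <> y -> (l * x + m = 0)%C -> (l * y + m = 0)%C -> l = 0%C /\ m = 0%C.
Proof.
intros Hxy Hx Hy.
assert (H : (l * (x - y) = 0)%C).
{ transitivity ((l * x + m) - (l * y + m))%C; [ring | rewrite Hx, Hy; ring]. }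
destruct (Cmult_eq_0 _ _ H) as [Hl|H'].
- split; auto. rewrite <- Hx, Hl. ring.
- exfalso. apply Hxy. now apply Ceq_minus.
Qed.

(** Among three points of a disc contained in [U], two are zeros of the same factor, and an affine
    function with two zeros is null. *)
Lemma affine_product_zero (U : C -> Prop) (l m l' m' x : C) :
  @open Cspace U -> U x ->
  (forall z, U z -> ((l * z + m) * (l' * z + m') = 0)%C) ->
  (l = 0%C /\ m = 0%C) \/ (l' = 0%C /\ m' = 0%C).
Proof.
intros oU Ux H.
assert (HU := oU x Ux). apply locally_Cmod in HU. destruct HU as [r [Hr HU]].
assert (Hp : forall s : R, 0 <= s < 1 -> U (x + RtoC (s * r))%C).
{ intros s Hs. apply HU. replace (x + RtoC (s * r) - x)%C with (RtoC (s * r)) by ring.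
  rewrite Cmod_R, Rabs_pos_eq by nra. nra. }
assert (Hne : forall s t : R, s <> t -> (x + RtoC (s * r))%C <> (x + RtoC (t * r))%C).
{ intros s t Hst E. apply Hst. apply Ceq_minus in E.
  replace (x + RtoC (s * r) - (x + RtoC (t * r)))%C with (RtoC ((s - t) * r)) in E
    by (rewrite !RtoC_mult, RtoC_minus; ring).
  apply RtoC_inj in E. nra. }
assert (A := Hne 0 (1/2) ltac:(lra)). assert (B := Hne 0 (1/3) ltac:(lra)).
assert (D := Hne (1/2) (1/3) ltac:(lra)).
destruct (Cmult_eq_0 _ _ (H _ (Hp 0 ltac:(lra)))) as [H1|H1];
destruct (Cmult_eq_0 _ _ (H _ (Hp (1/2) ltac:(lra)))) as [H2|H2];
destruct (Cmult_eq_0 _ _ (H _ (Hp (1/3) ltac:(lra)))) as [H3|H3];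
solve [ left; eapply affine_two_zeros; [exact A | assumption | assumption]
      | left; eapply affine_two_zeros; [exact B | assumption | assumption]
      | left; eapply affine_two_zeros; [exact D | assumption | assumption]
      | right; eapply affine_two_zeros; [exact A | assumption | assumption]
      | right; eapply affine_two_zeros; [exact B | assumption | assumption]
      | right; eapply affine_two_zeros; [exact D | assumption | assumption] ].
Qed.

Lemma primitive_cube_root (j : C) :
  primitive_root 3 j -> (j * j + j + 1 = 0)%C /\ j <> 1%C /\ j <> 0%C.
Proof.
intros [H3 Hm].
assert (H1 : j <> 1%C).
{ intros E. apply (Hm 1%nat ltac:(lia)). now rewrite Cpow_1_r. }
split; [|split; auto].
- assert (H : ((j - 1) * (j * j + j + 1) = 0)%C).
  { transitivity (j ^ 3 - 1)%C; [ring | rewrite H3; ring]. }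
  destruct (Cmult_eq_0 _ _ H) as [H'|H']; auto.
  exfalso. apply H1. now apply Ceq_minus.
- intros E. rewrite E in H3. apply C1_nz. rewrite <- H3. ring.
Qed.

Lemma complex_3_chambar (j : C) (U : C -> Prop) (X : nat -> C -> C) :
  primitive_root 3 j ->
  @open C_UniformSpace U -> @connected C_UniformSpace U -> complex_chambar 3 U X ->
  constant_fields 3 U X \/
  exists (i1 i2 i3 : nat) (a : C -> C) (lambda mu : C),
    Permutation (i1 :: i2 :: i3 :: nil) (1 :: 2 :: 3 :: nil)%nat /\
    lambda <> RtoC 0 /\
    holomorphic_on U a /\
    (forall x : C, U x -> (a x ^ 2 = lambda * x + mu)%C) /\
    (forall x : C, U x ->
       X i1 x = a x /\ X i2 x = (j * a x)%C /\ X i3 x = (j ^ 2 * a x)%C).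
Proof.
intros Hj oU' cU' [Hhol [Hnz [Hd Hbar]]].
assert (oU := proj1 (open_Cspace U) oU'). assert (cU := connected_Cspace U cU').
destruct Hbar as [E [HE Hbar]].
assert (DX : forall k x, (1 <= k <= 3)%nat -> U x ->
  is_Cderive (X k) x (C_derive (X k) x)).
{ intros k x Hk Ux. destruct (Hhol k Hk x Ux) as [l Hl].
  now apply (C_derive_is_Cderive _ _ l). }
assert (CX : forall k x, (1 <= k <= 3)%nat -> U x ->
  @continuous Cspace Cspace (X k) x).
{ intros k x Hk Ux. apply (is_Cderive_continuous _ _ _ (DX k x Hk Ux)). }
set (q := fun x => (X 1%nat x * (X 2%nat x * X 3%nat x))%C).
assert (DYZ : forall k x, (1 <= k <= 3)%nat -> U x -> @product C_AbsRing X x <> RtoC 0 ->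
  is_Cderive (C_derive (X k)) x (C_derive (C_derive (X k)) x) /\
  is_Cderive (C_derive (C_derive (X k))) x (C_derive (C_derive (C_derive (X k))) x)).
{ intros k x Hk Ux Hq. apply (flow_field_smooth U (X k) (E k)); auto.
  intros H. apply Hq. change (q x = 0%C). unfold q.
  destruct k as [|[|[|[|k]]]]; try lia; rewrite H; ring. }
destruct (@chambar_rigidity C_AbsRing (fun z => z)
  (fun _ _ => eq_refl) (fun _ _ => eq_refl) (fun _ _ H => H)
  is_Cderive_unique C_derive_zero U X (fun k => C_derive (X k))
  (fun k => C_derive (C_derive (X k))) (fun k => C_derive (C_derive (C_derive (X k))))
  oU cU DX DYZ Hd (ex_intro _ E (conj HE Hbar))) as [S0 [H|Hiso]]; [now left|].
assert (S0' : forall x, U x -> X 3%nat x = (- X 1%nat x - X 2%nat x)%C).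
{ intros x Ux. assert (H := S0 x Ux). rewrite sum_1_3 in H.
  change (X 1%nat x + (X 2%nat x + X 3%nat x) = 0)%C in H.
  transitivity ((X 1%nat x + (X 2%nat x + X 3%nat x)) - X 1%nat x - X 2%nat x)%C;
    [ring | rewrite H; ring]. }
assert (Q : forall x, U x ->
  (X 2%nat x * X 2%nat x = - X 1%nat x * X 1%nat x - X 1%nat x * X 2%nat x)%C).
{ intros x Ux. assert (H := proj1 (Hiso x Ux)). unfold sum_squares in H.
  rewrite sum_1_3 in H.
  change (X 1%nat x * X 1%nat x + (X 2%nat x * X 2%nat x + X 3%nat x * X 3%nat x) = 0)%C
    in H.
  rewrite (S0' x Ux) in H.
  assert (H' : (2 * (X 2%nat x * X 2%nat x
    - (- X 1%nat x * X 1%nat x - X 1%nat x * X 2%nat x)) = 0)%C)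
    by (rewrite <- H; ring).
  destruct (Cmult_eq_0 _ _ H') as [H1|H1]; [now apply (Cnonzero_num 2) in H1|].
  now apply Ceq_minus. }
assert (P1 : forall x, U x -> q x = (X 1%nat x ^ 3)%C).
{ intros x Ux. unfold q. rewrite (S0' x Ux).
  transitivity (- X 1%nat x * (X 1%nat x * X 2%nat x + X 2%nat x * X 2%nat x))%C; [ring|].
  rewrite (Q x Ux). ring. }
assert (P2 : forall x, U x -> q x = (X 2%nat x ^ 3)%C).
{ intros x Ux. unfold q. rewrite (S0' x Ux).
  transitivity (X 2%nat x * (- X 1%nat x * X 1%nat x - X 1%nat x * X 2%nat x))%C; [ring|].
  rewrite <- (Q x Ux). ring. }
assert (aff : forall k, (1 <= k <= 2)%nat -> exists l m : C, forall z, U z ->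
  (X k z * X k z = l * z + m)%C).
{ intros k Hk.
  apply (affine_of_second_derivative U (fun z => X k z * X k z)%C
    (fun z => C_derive (X k) z * X k z + X k z * C_derive (X k) z)%C); auto.
  - intros z Uz. apply is_Cderive_mult; apply DX; auto; lia.
  - intros z Uz Hz.
    assert (Hq : @product C_AbsRing X z <> RtoC 0).
    { change (q z <> 0%C).
      destruct k as [|[|[|k]]]; try lia; [rewrite P1 | rewrite P2]; auto;
        apply Cpow_nz; intros H; apply Hz; rewrite H; ring. }
    destruct (DYZ k z ltac:(lia) Uz Hq) as [DY _].
    assert (D1 := DX k z ltac:(lia) Uz).
    assert (G := proj2 (Hiso z Uz) Hq k Hk). cbv beta in G.
    change (C_derive (X k) z * C_derive (X k) z
      + X k z * C_derive (C_derive (X k)) z = 0)%C in G.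
    assert (D := is_Cderive_plus _ _ _ _ _
      (is_Cderive_mult _ _ _ _ _ DY D1) (is_Cderive_mult _ _ _ _ _ D1 DY)).
    match type of D with is_Cderive _ _ ?l => replace (RtoC 0) with l; [exact D|] end.
    transitivity (2 * (C_derive (X k) z * C_derive (X k) z
      + X k z * C_derive (C_derive (X k)) z))%C; [ring | rewrite G; ring]. }
destruct (aff 1%nat ltac:(lia)) as [l1 [m1 A1]].
destruct (aff 2%nat ltac:(lia)) as [l2 [m2 A2]].
destruct (Ceq_dec l1 0) as [Hl1|Hl1].
- left.
  apply (@constant_of_product_square C_AbsRing (fun z => z)
    (fun _ _ => eq_refl) (fun _ _ => eq_refl) (fun _ _ H => H) U X oU cU CX Hd); auto.
  + intros x Ux.
    exact (@Ccontinuous_mult Cspace _ _ x (CX 1%nat x ltac:(lia) Ux)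
      (@Ccontinuous_mult Cspace _ _ x (CX 2%nat x ltac:(lia) Ux) (CX 3%nat x ltac:(lia) Ux))).
  + intros x y Ux Uy. now rewrite (proj1 (Hiso x Ux)), (proj1 (Hiso y Uy)).
  (* With [l1 = 0] the square of [X 1] is the constant [m1], and [q^2] is its cube. *)
  + assert (Hsq : forall x, U x ->
      (q x * q x = m1 * m1 * m1)%C).
    { intros x Ux. rewrite P1 by auto.
      transitivity ((X 1%nat x * X 1%nat x) * (X 1%nat x * X 1%nat x)
        * (X 1%nat x * X 1%nat x))%C; [ring|].
      rewrite (A1 x Ux), Hl1. ring. }
    intros x y Ux Uy. exact (eq_trans (Hsq y Uy) (eq_sym (Hsq x Ux))).
- right. destruct (primitive_cube_root j Hj) as [J1 [J2 J3]].
  assert (Ej : (j * j = - j - 1)%C)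
    by (apply Ceq_minus; rewrite <- J1; ring).
  assert (Ej3 : (j * (j * j) = 1)%C).
  { rewrite Ej. transitivity (- (j * j) - j)%C; [ring | rewrite Ej; ring]. }
  assert (alt : forall x, U x -> X 2%nat x = (j * X 1%nat x)%C \/
     X 2%nat x = (j * j * X 1%nat x)%C).
  { intros x Ux.
    assert (H : ((X 2%nat x - j * X 1%nat x) * (X 2%nat x - j * j * X 1%nat x) = 0)%C).
    { transitivity (X 2%nat x * X 2%nat x - (j * j + j) * X 1%nat x * X 2%nat x
        + j * (j * j) * X 1%nat x * X 1%nat x)%C; [ring|].
      rewrite Ej3, Ej, (Q x Ux). ring. }
    destruct (Cmult_eq_0 _ _ H) as [H1|H1]; [left|right]; now apply Ceq_minus. }
  assert (Hjj : (j * (j - 1) <> 0)%C).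
  { apply Cmult_neq_0; auto. now apply Cminus_eq_contra. }
  (* The two candidates for [X 2] have squares [j^2 X1^2] and [j X1^2]; if these coincide at a
     point, [X 1] vanishes there and the candidates coincide too. *)
  assert (vanish : forall v : C, (j * j * (v * v) = j * (v * v))%C -> v = 0%C).
  { intros v H.
    assert (H' : (j * (j - 1) * (v * v) = 0)%C).
    { transitivity (j * j * (v * v) - j * (v * v))%C; [ring | rewrite H; ring]. }
    destruct (Cmult_eq_0 _ _ H') as [H1|H1]; [now elim Hjj|].
    destruct (Cmult_eq_0 _ _ H1); auto. }
  assert (sq : forall v : C, (j * j * v * (j * j * v) = j * (v * v))%C).
  { intros v. transitivity (j * (j * j) * j * (v * v))%C; [ring | rewrite Ej3; ring]. }
  destruct (Hnz 1%nat ltac:(lia)) as [x0 [Ux0 _]].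
  (* The alternative [alt] may a priori depend on the point. Comparing squares makes it global:
     [X2^2 - j^2 X1^2] and [X2^2 - j X1^2] are affine with zero product, so one of them vanishes
     identically. *)
  destruct (affine_product_zero U (l2 - j * j * l1) (m2 - j * j * m1)
    (l2 - j * l1) (m2 - j * m1) x0 oU Ux0) as [[L M]|[L M]].
  + intros z Uz.
    transitivity ((X 2%nat z * X 2%nat z - j * j * (X 1%nat z * X 1%nat z))
      * (X 2%nat z * X 2%nat z - j * (X 1%nat z * X 1%nat z)))%C.
    { rewrite (A1 z Uz), (A2 z Uz). ring. }
    destruct (alt z Uz) as [-> | ->]; [|rewrite sq]; ring.
  + assert (H2 : forall x, U x -> X 2%nat x = (j * X 1%nat x)%C).
    { intros x Ux. destruct (alt x Ux) as [H|H]; auto.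
      assert (V : X 1%nat x = 0%C).
      { apply vanish. rewrite <- sq, <- H, (A1 x Ux), (A2 x Ux).
        symmetry. apply Ceq_minus.
        transitivity ((l2 - j * j * l1) * x + (m2 - j * j * m1))%C;
          [ring | rewrite L, M; ring]. }
      rewrite H, V. ring. }
    exists 1%nat, 2%nat, 3%nat, (X 1%nat), l1, m1.
    split; [apply Permutation_refl|]. split; auto. split; [apply Hhol; lia|].
    split.
    * intros x Ux. rewrite <- (A1 x Ux). ring.
    * intros x Ux. split; auto. split; auto. rewrite (S0' x Ux), (H2 x Ux).
      transitivity ((- j - 1) * X 1%nat x)%C; [ring | rewrite <- Ej; ring].
  + assert (H2 : forall x, U x -> X 2%nat x = (j * j * X 1%nat x)%C).
    { intros x Ux. destruct (alt x Ux) as [H|H]; auto.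
      assert (V : X 1%nat x = 0%C).
      { apply vanish.
        transitivity (X 2%nat x * X 2%nat x)%C; [rewrite H; ring|].
        rewrite (A1 x Ux), (A2 x Ux). apply Ceq_minus.
        transitivity ((l2 - j * l1) * x + (m2 - j * m1))%C;
          [ring | rewrite L, M; ring]. }
      rewrite H, V. ring. }
    (* When [X 2] is [j^2 X 1], the relation [sum X = 0] makes [X 3] equal to [j X 1], so the last
       two fields trade places. *)
    exists 1%nat, 3%nat, 2%nat, (X 1%nat), l1, m1.
    split; [constructor; apply perm_swap|]. split; auto. split; [apply Hhol; lia|].
    split.
    * intros x Ux. rewrite <- (A1 x Ux). ring.
    * intros x Ux. split; auto. split; [|rewrite (H2 x Ux); ring].
      rewrite (S0' x Ux), (H2 x Ux), Ej. ring.
Qed.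

Theorem theorem6 :
  (forall (U : R -> Prop) (X : nat -> R -> R),
     open U -> connected U -> real_chambar 3 U X ->
     constant_fields 3 U X)
  /\
  (forall (j : C) (U : C -> Prop) (X : nat -> C -> C),
     primitive_root 3 j ->
     open U -> connected U -> complex_chambar 3 U X ->
     constant_fields 3 U X \/
     exists (i1 i2 i3 : nat) (a : C -> C) (lambda mu : C),
       Permutation (i1 :: i2 :: i3 :: nil) (1 :: 2 :: 3 :: nil)%nat /\
       lambda <> RtoC 0 /\
       holomorphic_on U a /\
       (forall x : C, U x -> (a x ^ 2 = lambda * x + mu)%C) /\
       (forall x : C, U x ->
          X i1 x = a x /\ X i2 x = (j * a x)%C /\ X i3 x = (j ^ 2 * a x)%C)).
Proof.
split; [exact real_3_chambar_constant | exact complex_3_chambar].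
Qed.
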